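(* Let $\mathcal{L}$ be a finite relational language in which all relation symbols have arity $\geq 2$. Then $\mathcal{C}_{\mathbf{S}_{\mathcal{L}}}=\mathcal{C}_{\mathbf{H}_{\mathrm{ari}(\mathcal{L})}}$.
   Context: Societies. $\mathrm{ari}(\mathcal{L})$ is the maximum arity of a relation symbol of $\mathcal{L}$. $\mathbf{S}_{\mathcal{L}}$, the class of $\mathcal{L}$-societies, is the class of all finite $\mathcal{L}$-structures in which every relation symbol $R$ of $\mathcal{L}$ is interpreted as an irreflexive ($R(\overline x)$ implies the $x_i$ are pairwise distinct) and symmetric (closed under all permutations of coordinates) relation. For $2\le r<\omega$, $\mathbf{H}_r$ is the class of finite $r$-hypergraphs: finite structures with one irreflexive symmetric $r$-ary relation $R$. These are algebraically trivial Fraïssé classes. Theories and the ordering $\trianglelefteq$. $\mathbb{T}$ is the class of all complete first-order (possibly many-sorted) theories with infinite models that eliminate imaginaries; $\mathcal{L}_T$ is the language of $T$. A theory $T$ that may not eliminate imaginaries is freely identified with $T^{\mathrm{eq}}$. Fix a countably infinite set $A$. For $T\in\mathbb{T}$, $\mathbf{F}(T)$ is the set of injections $f:B\to M$, where $B\subset A$ is finite and $M$ is the universe of some model $\mathcal{M}\models T$, such that all $f(a)$, $a\in B$, lie in one sort, and for every $B_0\subsetneq B$ the type $\mathrm{tp}(f[B]/f[B_0])$ is non-algebraic. A sequence $\boldsymbol\phi=(\phi_0,\dots,\phi_{N-1})$ of $\mathcal{L}_T$-formulas is always finite and all free variables range over one common sort (the sort of $\boldsymbol\phi$); if $\phi_i=\phi_i(x_0,\dots,x_{n_i-1})$,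 then $\mathcal{L}_{\boldsymbol\phi}$ is the one-sorted language with signature $\{R_0^{(n_0)},\dots,R_{N-1}^{(n_{N-1})}\}$ (the languages of two sequences that coordinate-wise have the same arities are identified). $\mathbf{F}_{\boldsymbol\phi}(T)$ is the set of $f\in\mathbf{F}(T)$ with values in the sort of $\boldsymbol\phi$; for such $f:B\to M$, $B_{\boldsymbol\phi}(f)$ is the $\mathcal{L}_{\boldsymbol\phi}$-structure with universe $B$ and $R_i=\{\overline a\in B^{n_i}:\mathcal{M}\models\phi_i(f\overline a)\}$. $\mathrm{Age}_{\boldsymbol\phi}(T)=\{B_{\boldsymbol\phi}(f):f\in\mathbf{F}_{\boldsymbol\phi}(T)\}$ up to isomorphism. For $T_1,T_2\in\mathbb{T}$, $T_1\trianglelefteq T_2$ means: for every finite sequence $\boldsymbol\phi^1$ of $\mathcal{L}_{T_1}$-formulas there is a sequence $\boldsymbol\phi^2$ of $\mathcal{L}_{T_2}$-formulas, coordinate-wise of the same arities, with $\mathrm{Age}_{\boldsymbol\phi^1}(T_1)\subseteq\mathrm{Age}_{\boldsymbol\phi^2}(T_2)$. Fraïssé classes. A Fraïssé class is a class of finite structures in a one-sorted finite relational language having the hereditary, joint-embedding and amalgamation properties. $T_{\mathbf{K}}$ is the complete theory of the generic model (Fraïssé limit) of $\mathbf{K}$. $\mathbf{K}$ is algebraically trivial if $\mathrm{acl}^{\mathcal{M}}(X)=X$ for all $\mathcal{M}\models T_{\mathbf{K}}$ and $X\subseteq M$. For such $\mathbf{K}$, $\mathcal{C}_{\mathbf{K}}=\{T\in\mathbb{T}:T_{\mathbf{K}}\trianglelefteq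 T\}$. *)

(* Defs.v *)
From mathcomp Require Import all_boot perm finmap.
From mathcomp Require Import boolp classical_sets functions cardinality.

Set Implicit Arguments.
Unset Strict Implicit.
Unset Printing Implicit Defensive.

Local Open Scope classical_set_scope.

(** * Many-sorted first-order logic *)

Record language : Type := Language {
  lsort : Type;
  fsym : Type;
  far : fsym -> nat;
  fdom : forall g : fsym, 'I_(far g) -> lsort;
  fcod : fsym -> lsort;
  rsym : Type;
  rar : rsym -> nat;
  rdom : forall R : rsym, 'I_(rar R) -> lsort
}.

(* Variables are well-scoped and well-sorted: a context of length n assigns
   a sort to each variable in 'I_n. *)
Definition ctx (L : language) (n : nat) : Type := 'I_n -> lsort L.

Definition ctx_nil (L : language) : ctx L 0 :=
  fun i => match notF (ltn_ord i) with end.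

Definition ctx_const (L : language) (n : nat) (s : lsort L) : ctx L n :=
  fun _ => s.
Arguments ctx_const {L} n s.

(* The new variable is ord0; the old variable j becomes lift ord0 j. *)
Definition ctx_ext (L : language) (n : nat) (c : ctx L n) (s : lsort L) :
    ctx L n.+1 :=
  fun i => oapp c s (unlift ord0 i).

Definition ctx_cat (L : language) (m n : nat) (c : ctx L m) (d : ctx L n) :
    ctx L (m + n) :=
  fun i => match fintype.split i with inl j => c j | inr k => d k end.

Inductive term (L : language) (n : nat) (c : ctx L n) : lsort L -> Type :=
| tvar (i : 'I_n) : term c (c i)
| tapp (g : fsym L) (ts : forall i : 'I_(far g), term c (fdom i)) :
    term c (fcod g).

Inductive formula (L : language) (n : nat) (c : ctx L n) : Type :=
| fbot : formula c
| feq (s : lsort L) (t1 t2 : term c s) : formula c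
| frel (R : rsym L) (ts : forall i : 'I_(rar R), term c (rdom i)) : formula c
| fimp (phi psi : formula c) : formula c
| fall (s : lsort L) (phi : formula (ctx_ext c s)) : formula c.

Definition sentence (L : language) : Type := formula (ctx_nil L).

Definition fneg (L : language) (n : nat) (c : ctx L n) (phi : formula c) :
    formula c :=
  fimp phi (fbot c).

(* Sorts may be empty here, so that finite structures may be empty;
   non-emptiness is part of [models]. *)
Record structure (L : language) : Type := Structure {
  carrier :> lsort L -> Type;
  finterp : forall g : fsym L,
    (forall i : 'I_(far g), carrier (fdom i)) -> carrier (fcod g);
  rinterp : forall R : rsym L,
    (forall i : 'I_(rar R), carrier (rdom i)) -> Prop
}.

Definition asg (L : language) (M : structure L) (n : nat) (c : ctx L n) :
    Type :=
  forall i : 'I_n, M (c i).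

Definition asg_nil (L : language) (M : structure L) : asg M (ctx_nil L) :=
  fun i => match notF (ltn_ord i) with end.

Definition asg_ext (L : language) (M : structure L) (n : nat) (c : ctx L n)
    (a : asg M c) (s : lsort L) (x : M s) : asg M (ctx_ext c s) :=
  fun i => match unlift ord0 i as o return M (oapp c s o) with
           | Some j => a j
           | None => x
           end.

Definition asg_cat (L : language) (M : structure L) (m n : nat)
    (c : ctx L m) (d : ctx L n) (a : asg M c) (b : asg M d) :
    asg M (ctx_cat c d) :=
  fun i => match fintype.split i as u
             return M (match u with inl j => c j | inr k => d k end) with
           | inl j => a j
           | inr k => b k
           end.

Fixpoint eval (L : language) (M : structure L) (n : nat) (c : ctx L n)
    (a : asg M c) (s : lsort L) (t : term c s) {struct t} : M s :=
  match t in term _ s0 return M s0 with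
  | tvar i => a i
  | tapp g ts => finterp (fun i => eval a (ts i))
  end.

Fixpoint sat (L : language) (M : structure L) (n : nat) (c : ctx L n)
    (phi : formula c) {struct phi} : asg M c -> Prop :=
  match phi with
  | fbot => fun _ => False
  | feq s t1 t2 => fun a => eval a t1 = eval a t2
  | frel R ts => fun a => rinterp (fun i => eval a (ts i))
  | fimp phi1 phi2 => fun a => sat phi1 a -> sat phi2 a
  | fall s phi1 => fun a => forall x : M s, sat phi1 (asg_ext a x)
  end.

Definition holds (L : language) (M : structure L) (phi : sentence L) : Prop :=
  sat phi (asg_nil M).

Definition theory (L : language) : Type := set (sentence L).

Definition models (L : language) (T : theory L) (M : structure L) : Prop :=
  (forall s : lsort L, inhabited (M s)) /\ (forall phi, T phi -> holds M phi).

Definition entails (L : language) (T : theory L) (phi : sentence L) : Prop :=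
  forall M : structure L, models T M -> holds M phi.

Definition complete (L : language) (T : theory L) : Prop :=
  (exists M : structure L, models T M) /\
  (forall phi : sentence L, entails T phi \/ entails T (fneg phi)).

Definition universe (L : language) (M : structure L) : Type :=
  {s : lsort L & M s}.

Definition has_infinite_model (L : language) (T : theory L) : Prop :=
  exists2 M : structure L, models T M & infinite_set [set: universe M].

(** * Imaginaries *)

Definition defines_equivalence (L : language) (M : structure L) (n : nat)
    (c : ctx L n) (E : formula (ctx_cat c c)) : Prop :=
  let r (a b : asg M c) := sat E (asg_cat a b) in
  [/\ forall a, r a a,
      forall a b, r a b -> r b a
    & forall a b d, r a b -> r b d -> r a d].

(* Every class of a 0-definable equivalence relation on tuples is of the form
   phi(M, b) for a unique tuple b (Hodges, Model Theory, section 4.4). *)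
Definition eliminates_imaginaries (L : language) (T : theory L) : Prop :=
  forall M : structure L, models T M ->
  forall (n : nat) (c : ctx L n) (E : formula (ctx_cat c c)),
  defines_equivalence M E ->
  forall a : asg M c,
  exists (m : nat) (d : ctx L m) (phi : formula (ctx_cat c d)),
  exists! b : asg M d,
    forall x : asg M c, sat E (asg_cat x a) <-> sat phi (asg_cat x b).

Record imaginary (L : language) (T : theory L) : Type := Imaginary {
  im_ar : nat;
  im_ctx : ctx L im_ar;
  im_rel : formula (ctx_cat im_ctx im_ctx);
  im_equiv : forall M : structure L, models T M -> defines_equivalence M im_rel
}.

(* The language of T^eq: the home sorts and symbols of L, a new sort for each
   0-definable equivalence relation E, and a function symbol for the projection
   of tuples onto their E-classes. *)
Definition eq_language (L : language) (T : theory L) : language :=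
  @Language
    (lsort L + imaginary T)
    (fsym L + imaginary T)
    (fun g => match g with inl g => far g | inr E => im_ar E end)
    (fun g => match g return
         'I_(match g with inl g => far g | inr E => im_ar E end) ->
         lsort L + imaginary T with
       | inl g => fun i => inl (@fdom L g i)
       | inr E => fun i => inl (im_ctx i)
       end)
    (fun g => match g with inl g => inl (fcod g) | inr E => inr E end)
    (rsym L)
    (@rar L)
    (fun R i => inl (@rdom L R i)).

Definition im_class (L : language) (T : theory L) (M : structure L)
    (E : imaginary T) (a : asg M (@im_ctx L T E)) :
    set (asg M (@im_ctx L T E)) :=
  [set b | sat (im_rel E) (asg_cat a b)].

Definition eq_carrier (L : language) (T : theory L) (M : structure L)
    (s : lsort (eq_language T)) : Type :=
  match s with
  | inl s => M s
  | inr E => {X : set (asg M (@im_ctx L T E)) | exists a, X = im_class a}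
  end.

(* M^eq *)
Definition eq_structure (L : language) (T : theory L) (M : structure L) :
    structure (eq_language T) :=
  @Structure (eq_language T) (@eq_carrier L T M)
    (fun g => match g return
         (forall i : 'I_(@far (eq_language T) g),
            @eq_carrier L T M (fdom i)) ->
         @eq_carrier L T M (@fcod (eq_language T) g) with
       | inl g => fun a => @finterp L M g a
       | inr E => fun a =>
           exist _ (@im_class L T M E a) (ex_intro _ a (erefl _))
       end)
    (fun R a => @rinterp L M R a).

(* T^eq *)
Definition eq_theory (L : language) (T : theory L) :
    theory (eq_language T) :=
  [set phi | forall M : structure L,
     models T M -> holds (eq_structure T M) phi].
Arguments eq_theory {L} T _.

(* The class of all complete theories with infinite models that eliminate
   imaginaries. *)
Record TT : Type := MkTT {
  TT_lang : language;
  TT_theory :> theory TT_lang;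
  TT_complete : complete TT_theory;
  TT_infinite : has_infinite_model TT_theory;
  TT_ei : eliminates_imaginaries TT_theory
}.

(** * One-sorted finite relational languages *)

Record rel_language : Type := RelLanguage {
  sym :> finType;
  ar : sym -> nat
}.

Definition rel_structure (L : rel_language) (A : Type) : Type :=
  forall R : L, ('I_(ar R) -> A) -> Prop.

(* [f] is an isomorphism of [S] onto an induced substructure of [S']. *)
Definition embedding (L : rel_language) (A A' : Type)
    (S : rel_structure L A) (S' : rel_structure L A') (f : A -> A') : Prop :=
  injective f /\
  (forall (R : L) (x : 'I_(ar R) -> A), S R x <-> S' R (fun i => f (x i))).

Definition isomorphic (L : rel_language) (A A' : Type)
    (S : rel_structure L A) (S' : rel_structure L A') : Prop :=
  exists2 f : A -> A', bijective f & embedding S S' f.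

Definition fo_language (L : rel_language) : language :=
  @Language unit Empty_set
    (fun g => match g with end) (fun g => match g with end)
    (fun g => match g with end)
    (sym L) (@ar L) (fun _ _ => tt).

Definition fo_structure (L : rel_language) (A : Type)
    (S : rel_structure L A) : structure (fo_language L) :=
  @Structure (fo_language L) (fun _ => A)
    (fun g => match g with end)
    (fun R a => S R a).

(* Classes of finite L-structures. *)
Definition fin_class (L : rel_language) : Type :=
  forall A : finType, set (rel_structure L A).

(** * Generic models *)

Definition in_age (L : rel_language) (A : Type) (M : rel_structure L A)
    (B : finType) (S : rel_structure L B) : Prop :=
  exists f : B -> A, embedding S M f.

(* Two enumerated copies in M of one finite structure are conjugate under an
   automorphism of M. *)
Definition ultrahomogeneous (L : rel_language) (A : Type)
    (M : rel_structure L A) : Prop :=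
  forall (B : finType) (S : rel_structure L B) (f g : B -> A),
  embedding S M f -> embedding S M g ->
  exists h : A -> A, [/\ bijective h, embedding M M h
                       & forall b, h (f b) = g b].

Definition generic_model (L : rel_language) (K : fin_class L) (A : Type)
    (M : rel_structure L A) : Prop :=
  [/\ countable [set: A],
      ultrahomogeneous M
    & forall (B : finType) (S : rel_structure L B), K B S <-> in_age M S].

Definition T_ (L : rel_language) (K : fin_class L) : theory (fo_language L) :=
  [set phi | forall (A : Type) (M : rel_structure L A),
     generic_model K M -> holds (fo_structure M) phi].

(** * The ordering of theories *)

(* The type of the tuple a over the parameter set C is algebraic: it contains
   a formula over C with finitely many realisations. *)
Definition algebraic_type (L : language) (M : structure L) (s : lsort L)
    (n : nat) (a : 'I_n -> M s) (C : set (M s)) : Prop :=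
  exists (m : nat) (p : 'I_m -> M s)
         (phi : formula (ctx_cat (ctx_const n s) (ctx_const m s))),
  let D : set ('I_n -> M s) := [set x |
    sat phi (@asg_cat L M n m (ctx_const n s) (ctx_const m s) x p)] in
  [/\ forall j, C (p j), D a & finite_set D].

Definition in_F (L : language) (T : theory L) (M : structure L) (s : lsort L)
    (B : finType) (f : B -> M s) : Prop :=
  [/\ models T M, injective f
    & forall B0 : {set B}, B0 \proper [set: B]%SET ->
        ~ algebraic_type (fun i : 'I_#|B| => f (enum_val i))
                         (f @` [set b | b \in B0])].

(* phi_0, ..., phi_(N-1), where phi_i has arity n i and all variables range
   over the sort s. *)
Definition formula_seq (L : language) (N : nat) (n : 'I_N -> nat)
    (s : lsort L) : Type :=
  forall i : 'I_N, formula (ctx_const (n i) s).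

Definition seq_language (N : nat) (n : 'I_N -> nat) : rel_language :=
  @RelLanguage 'I_N n.

Definition B_ (L : language) (M : structure L) (s : lsort L) (N : nat)
    (n : 'I_N -> nat) (phi : formula_seq n s) (B : Type) (f : B -> M s) :
    rel_structure (seq_language n) B :=
  fun i a => @sat L M (n i) (ctx_const (n i) s) (phi i) (fun j => f (a j)).

(* The countably infinite set of which the domains B are finite subsets is
   taken to be nat. *)
Definition Age (L : language) (T : theory L) (s : lsort L) (N : nat)
    (n : 'I_N -> nat) (phi : formula_seq n s) : fin_class (seq_language n) :=
  fun (C : finType) => [set S : rel_structure (seq_language n) C |
    exists (M : structure L) (B : {fset nat}) (f : B -> M s),
      in_F T f /\ isomorphic S (B_ phi f)].
Arguments Age {L} T {s N n} phi A _.

Definition trianglelefteq (L1 L2 : language) (T1 : theory L1)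
    (T2 : theory L2) : Prop :=
  forall (N : nat) (n : 'I_N -> nat) (s1 : lsort L1) (phi1 : formula_seq n s1),
  exists (s2 : lsort L2) (phi2 : formula_seq n s2),
  forall C : finType, Age T1 phi1 C `<=` Age T2 phi2 C.

(* As T_ K need not eliminate imaginaries, it stands for its T^eq. *)
Definition C_ (L : rel_language) (K : fin_class L) (T : TT) : Prop :=
  trianglelefteq (eq_theory (T_ K)) T.

(** * Societies and hypergraphs *)

Definition irreflexive_rel (k : nat) (A : Type)
    (R : ('I_k -> A) -> Prop) : Prop :=
  forall x : 'I_k -> A, R x -> injective x.

Definition symmetric_rel (k : nat) (A : Type)
    (R : ('I_k -> A) -> Prop) : Prop :=
  forall (x : 'I_k -> A) (p : 'S_k), R x -> R (fun i => x (p i)).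

Definition S_ (L : rel_language) : fin_class L :=
  fun A => [set S : rel_structure L A |
    forall R : L, irreflexive_rel (S R) /\ symmetric_rel (S R)].
Arguments S_ L A _ : clear implicits.

Definition ari (L : rel_language) : nat := \max_(R : L) ar R.

Definition hypergraph_language (r : nat) : rel_language :=
  @RelLanguage unit (fun _ => r).

(* Meant for 2 <= r. *)
Definition H_ (r : nat) : fin_class (hypergraph_language r) :=
  fun A => [set S : rel_structure (hypergraph_language r) A |
    irreflexive_rel (S tt) /\ symmetric_rel (S tt)].
Arguments H_ r A _ : clear implicits.

(* Main.v *)
Require Import Defs.
From mathcomp Require Import all_boot.
From mathcomp Require Import perm finmap.
From mathcomp Require Import boolp classical_sets functions cardinality.

(** The ordering of theories is transitive, so the two classes coincide as soon
    as the theory of the generic [L]-society and that of the generic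
    [ari L]-hypergraph lie below each other.  Hypergraphs are societies over a
    single symbol, and both comparisons are instances of [eq_society_le]: if no
    arity of [L] exceeds that of some symbol [R0] of [L'], then the theory of
    generic [L]-societies lies below that of generic [L']-societies.  For one
    direction [R0] is a symbol of [L] of maximal arity, for the other it is the
    edge relation.

    The first ingredient is that in the theory of a Fraisse limit, imaginaries
    included, the type of a tuple depends only on the finite structure carried
    by representatives of its entries ([eq_sat]).  This is proved by back and
    forth ([back_and_forth]).  The extension property holds between any two
    limits by homogeneity; it is passed on to all models of the theory, and from
    these to all models of the theory with imaginaries, because invariance of a
    formula under partial isomorphisms is expressed by sentences
    ([transfer_invariant]).  So a configuration in the age of a sequence of
    formulas of the first theory is read off from a finite [L]-society.

    The second ingredient is a code for finite [L]-societies ([coded]).  Each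
    element [a] becomes a finite set of vertices [(a, (R, o))], and each
    instance of a relation [R] of arity at most that of [R0] becomes an edge of
    [R0], padded with vertices reserved for that purpose.  A tuple of elements
    of the society becomes a tuple of vertices, that is, a single element of a
    sort of tuples over the second theory.  That the decoded tuple satisfies a
    given formula is a property of the quantifier-free type of the coordinates,
    hence first-order ([coordinate_formula]).

    Membership in an age also demands injectivity and non-algebraic types.
    Adding to each tuple a private vertex, isolated from all others, secures
    both at once ([fresh_in_F]), whatever the rest of the tuple is.

    The generic society exists: [random] is an explicit one on the natural
    numbers, in the manner of the Rado graph ([random_generic]). *)

Set Implicit Arguments.
Unset Strict Implicit.
Unset Printing Implicit Defensive.

(** * Back-and-forth for many-sorted logic *)

Section BackAndForth.
Variables (L : language) (M M' : structure L) (W : Type).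
Variable rel : W -> forall s : lsort L, M s -> M' s -> Prop.

Hypothesis rel_eq : forall w s (x y : M s) (x' y' : M' s),
  rel w x x' -> rel w y y' -> (x = y <-> x' = y').
Hypothesis rel_fun : forall w g (x : forall i : 'I_(far g), M (fdom i)) x',
  (forall i, rel w (x i) (x' i)) -> rel w (finterp x) (finterp x').
Hypothesis rel_rel : forall w R (x : forall i : 'I_(rar R), M (rdom i)) x',
  (forall i, rel w (x i) (x' i)) -> (rinterp x <-> rinterp x').

Let extends w v := forall s (y : M s) (y' : M' s), rel w y y' -> rel v y y'.

Hypothesis rel_forth : forall w s (x : M s),
  exists v, extends w v /\ exists x', rel v x x'.
Hypothesis rel_back : forall w s (x' : M' s),
  exists v, extends w v /\ exists x, rel v x x'.

(** The indices [w] are the stages of a back-and-forth system between [M] and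
    [M'], and [rel w] lists the pairs matched at stage [w].  A quantifier is
    crossed by moving to a later stage, so the statement must be proved at all
    stages at once. *)
Lemma back_and_forth n (c : ctx L n) (phi : formula c) w (a : asg M c)
    (a' : asg M' c) :
  (forall i, rel w (a i) (a' i)) -> (sat phi a <-> sat phi a').
Proof.
have rel_eval m (d : ctx L m) v (b : asg M d) (b' : asg M' d) :
    (forall i, rel v (b i) (b' i)) ->
    forall s (t : term d s), rel v (eval b t) (eval b' t).
  move=> bb' s; elim=> [i|g ts IH]; [exact: bb' | exact: rel_fun].
have rel_ext m (d : ctx L m) w' v (b : asg M d) (b' : asg M' d) s
    (x : M s) x' :
    (forall i, rel w' (b i) (b' i)) -> extends w' v -> rel v x x' ->
    forall i, rel v (asg_ext b x i) (asg_ext b' x' i).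
  move=> bb' wv xx' i; rewrite /asg_ext /ctx_ext.
  by case: (unlift ord0 i) => [j|] //=; apply/wv/bb'.
elim: phi w a a' => {n c} [|n c s t1 t2|n c R ts|n c p IHp q IHq|n c s p IH]
  w a a' aa' /=.
- by [].
- by apply: rel_eq; apply: rel_eval.
- by apply: rel_rel => i; apply: rel_eval.
- by have := IHp w a a' aa'; have := IHq w a a' aa'; tauto.
split=> sat_p => [x'|x].
  have [v [wv [x xx']]] := rel_back w x'.
  by apply/(IH v _ _ (rel_ext _ _ _ _ _ _ _ _ _ aa' wv xx')); apply: sat_p.
have [v [wv [x' xx']]] := rel_forth w x.
by apply/(IH v _ _ (rel_ext _ _ _ _ _ _ _ _ _ aa' wv xx')); apply: sat_p.
Qed.

End BackAndForth.

(** * Finite partial isomorphisms *)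

Definition pull (L : rel_language) (A I : Type) (S : rel_structure L A)
    (z : I -> A) : rel_structure L I :=
  fun R t => S R (fun i => z (t i)).

Lemma embedding_pull (L : rel_language) (A I : Type) (S : rel_structure L A)
    (z : I -> A) : injective z -> embedding (pull S z) S z.
Proof. by move=> injz; split. Qed.

(** A finite partial isomorphism from [S] to [S'], given by two embeddings of a
    common finite structure instead of two finite subsets; the elements are then
    named by indices and membership in a domain never has to be decided. *)
Record world (L : rel_language) (A A' : Type) (S : rel_structure L A)
    (S' : rel_structure L A') := World {
  idx : finType;
  dia : rel_structure L idx;
  lmap : idx -> A;
  rmap : idx -> A';
  lmap_emb : embedding dia S lmap;
  rmap_emb : embedding dia S' rmap
}.
Arguments dia {L A A' S S'} w R _ : rename.

Section Worlds.
Variable L : rel_language.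

Definition le_world A A' (S : rel_structure L A) (S' : rel_structure L A')
    (w v : world S S') : Prop :=
  exists f : idx w -> idx v,
    (forall i, lmap (f i) = lmap i) /\ (forall i, rmap (f i) = rmap i).

Lemma le_world_refl A A' (S : rel_structure L A) (S' : rel_structure L A')
  (w : world S S') : le_world w w.
Proof. by exists id. Qed.

Lemma le_world_trans A A' (S : rel_structure L A) (S' : rel_structure L A')
  (u v w : world S S') : le_world u v -> le_world v w -> le_world u w.
Proof.
move=> [f [fl fr]] [g [gl gr]]; exists (fun i => g (f i)).
by split=> i; rewrite ?gl ?gr.
Qed.

Definition flip A A' (S : rel_structure L A) (S' : rel_structure L A')
    (w : world S S') : world S' S :=
  World (rmap_emb w) (lmap_emb w).

(** The new point is required to lie outside the range of [z], which keeps both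
    maps injective; a point inside the range is already named. *)
Definition one_step A A' (S : rel_structure L A) (S' : rel_structure L A') :
    Prop :=
  forall (I : finType) (Q : rel_structure L I) z z',
  embedding Q S z -> embedding Q S' z' ->
  forall x, (forall i, z i <> x) ->
  exists x', embedding (pull S (oapp z x)) S' (oapp z' x').

Lemma oapp_inj A (I : Type) (z : I -> A) x :
  injective z -> (forall i, z i <> x) -> injective (oapp z x).
Proof.
move=> injz zx [i|] [j|] //= e; first by rewrite (injz _ _ e).
  by case: (zx i).
by case: (zx j).
Qed.

Lemma world_cover A A' (S : rel_structure L A) (S' : rel_structure L A') :
  one_step S S' -> forall (w : world S S') x,
  exists v, le_world w v /\ exists i : idx v, lmap i = x.
Proof.
move=> step w x; case: (pselect (exists i : idx w, lmap i = x)) => [wx|].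
  by exists w; split=> //; apply: le_world_refl.
move=> /forallNP wx.
have [x' emb'] := step _ _ _ _ (lmap_emb w) (rmap_emb w) x wx.
have emb := embedding_pull S (oapp_inj (proj1 (lmap_emb w)) wx).
exists (World emb emb'); split; first by exists Some.
by exists None.
Qed.

Lemma world_covers A A' (S : rel_structure L A) (S' : rel_structure L A') :
  one_step S S' -> forall (w : world S S') (K : finType) (y : K -> A),
  exists v, le_world w v /\ exists t : K -> idx v, forall k, lmap (t k) = y k.
Proof.
move=> step w K y.
suff [v [wv yv]] : exists v, le_world w v /\
    forall k, k \in enum K -> exists i : idx v, lmap i = y k.
  exists v; split=> //.
  have /choice [t ty] : forall k, exists i : idx v, lmap i = y k.
    by move=> k; apply: yv; rewrite mem_enum.
  by exists t.
elim: (enum K) => [|k s [v [wv vs]]].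
  by exists w; split=> //; apply: le_world_refl.
have [u [[f [fl fr]] [i iu]]] := world_cover step v (y k).
exists u; split; first by apply: (le_world_trans wv); exists f.
move=> j; rewrite inE => /orP[/eqP-> | /vs[i' <-]]; first by exists i.
by exists (f i').
Qed.

(** Choosing one index in each fibre of [y] makes [y] injective without losing
    any of its values; the fibres of [y'] are the same, so the same choice works
    for [y']. *)
Lemma pattern_world A A' (S : rel_structure L A) (S' : rel_structure L A')
    (I : finType) (y : I -> A) (y' : I -> A') :
  (forall i j, y i = y j <-> y' i = y' j) ->
  (forall R (t : 'I_(ar R) -> I), pull S y t <-> pull S' y' t) ->
  exists (w : world S S') (t : I -> idx w),
    (forall i, lmap (t i) = y i) /\ (forall i, rmap (t i) = y' i).
Proof.
move=> yy rr.
pose rep i := odflt i [pick j | `[<y j = y i>]].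
have repE i : y (rep i) = y i.
  by rewrite /rep; case: pickP => [j /asboolP|] //=.
have rep_id i j : y i = y j -> rep i = rep j.
  move=> e; rewrite /rep e; case: pickP => //= /(_ j).
  by rewrite asboolT.
pose J := {i : I | rep i == i}.
have zinj : injective (fun j : J => y (val j)).
  move=> i j /rep_id e; apply: val_inj.
  by rewrite -(eqP (valP i)) -(eqP (valP j)).
have z'inj : injective (fun j : J => y' (val j)).
  by move=> i j /yy; apply: zinj.
have emb := embedding_pull S zinj.
have emb' : embedding (pull S (fun j : J => y (val j))) S'
    (fun j : J => y' (val j)).
  by split=> // R t; apply: (rr R (fun i => val (t i))).
have repK i : rep (rep i) == rep i by apply/eqP/rep_id/repE.
exists (World emb emb'), (fun i => exist _ (rep i) (repK i) : J).
by split=> i //=; apply/yy.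
Qed.

End Worlds.

Lemma le_world_flip (L : rel_language) A A' (S : rel_structure L A)
    (S' : rel_structure L A') (w v : world S S') :
  le_world w v -> le_world (flip w) (flip v).
Proof. by move=> [f [fl fr]]; exists f. Qed.

(** * Definability as a property of families of relations *)

Section Definability.
Variables (L : language).

(** The sort of the variable [lift ord0 j] is [c j] only up to a propositional
    equality.  Generalizing over the value of [unlift] replaces a transport of
    terms along that equality by an existence statement. *)
Lemma weaken_term n (c : ctx L n) (r q : lsort L) (t : term c q) :
  exists t' : term (ctx_ext c r) q,
    forall (M : structure L) (a : asg M c) (x : M r),
      eval (asg_ext a x) t' = eval a t.
Proof.
elim: t => [j|g ts IH].
  have : forall o, unlift ord0 (lift ord0 j) = o ->
      exists t' : term (ctx_ext c r) (oapp c r o),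
        forall (M : structure L) (a : asg M c) (x : M r),
        eval (asg_ext a x) t' =
          match o as o return M (oapp c r o) with Some j => a j | None => x end.
    by move=> o <-; exists (tvar _ (lift ord0 j)).
  by move=> /(_ _ (liftK ord0 j)).
exists (tapp (fun i => sval (cid (IH i)))) => M a x /=.
by congr finterp; apply: functional_extensionality_dep => i; case: cid.
Qed.

Lemma fresh_term n (c : ctx L n) (r : lsort L) :
  exists t : term (ctx_ext c r) r,
    forall (M : structure L) (a : asg M c) (x : M r), eval (asg_ext a x) t = x.
Proof.
have : forall o, unlift ord0 ord0 = o ->
    exists t : term (ctx_ext c r) (oapp c r o),
      forall (M : structure L) (a : asg M c) (x : M r),
      eval (asg_ext a x) t =
        match o as o return M (oapp c r o) with Some j => a j | None => x end.
  by move=> o <-; exists (tvar _ ord0).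
by move=> /(_ _ (unlift_none ord0)).
Qed.

Lemma left_term m n (c : ctx L m) (d : ctx L n) (i : 'I_m) :
  exists t : term (ctx_cat c d) (c i),
    forall (M : structure L) (a : asg M c) (b : asg M d),
      eval (asg_cat a b) t = a i.
Proof.
have : forall u, fintype.split (lshift n i) = u ->
    exists t : term (ctx_cat c d)
        (match u with inl j => c j | inr k => d k end),
      forall (M : structure L) (a : asg M c) (b : asg M d),
      eval (asg_cat a b) t = match u as u
        return M (match u with inl j => c j | inr k => d k end)
        with inl j => a j | inr k => b k end.
  by move=> u <-; exists (tvar _ (lshift n i)).
by move=> /(_ _ (unsplitK (inl i))).
Qed.

Lemma right_term m n (c : ctx L m) (d : ctx L n) (i : 'I_n) :
  exists t : term (ctx_cat c d) (d i),
    forall (M : structure L) (a : asg M c) (b : asg M d),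
      eval (asg_cat a b) t = b i.
Proof.
have : forall u, fintype.split (rshift m i) = u ->
    exists t : term (ctx_cat c d)
        (match u with inl j => c j | inr k => d k end),
      forall (M : structure L) (a : asg M c) (b : asg M d),
      eval (asg_cat a b) t = match u as u
        return M (match u with inl j => c j | inr k => d k end)
        with inl j => a j | inr k => b k end.
  by move=> u <-; exists (tvar _ (rshift m i)).
by move=> /(_ _ (unsplitK (inr i))).
Qed.

Section Queries.
Variables s h : lsort L.

Definition query (J I : Type) : Type :=
  forall M : structure L, (J -> M s) -> (I -> M h) -> Prop.

(** Asking for a formula in each context, with terms in place of the variables,
    makes definability stable under weakening and substitution by construction;
    no renaming of formulas is ever needed.  Both blocks of arguments have a
    constant sort: [s] for the parameters and [h] for home elements. *)
Definition definable (J I : Type) (P : query J I) : Prop :=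
  forall n (c : ctx L n) (v : J -> term c s) (u : I -> term c h),
  exists phi : formula c, forall (M : structure L) (a : asg M c),
    sat phi a <-> P M (fun j => eval a (v j)) (fun i => eval a (u i)).

Lemma definable_ext J I (P Q : query J I) :
  definable P -> (forall M x y, P M x y <-> Q M x y) -> definable Q.
Proof.
by move=> dP PQ n c v u; have [p pE] := dP n c v u; exists p => M a; rewrite pE.
Qed.

Lemma definable_imp J I (P Q : query J I) : definable P -> definable Q ->
  definable (fun M x y => P M x y -> Q M x y).
Proof.
move=> dP dQ n c v u; have [p pE] := dP n c v u; have [q qE] := dQ n c v u.
by exists (fimp p q) => M a /=; rewrite pE qE.
Qed.

Lemma definable_prop J I (p : Prop) : definable (J:=J) (I:=I) (fun _ _ _ => p).
Proof.
case: (pselect p) => hp n c v u; last by exists (fbot c).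
by exists (fimp (fbot c) (fbot c)) => M a /=; tauto.
Qed.

Lemma definable_not J I (P : query J I) : definable P ->
  definable (fun M x y => ~ P M x y).
Proof. by move=> dP; apply: definable_imp dP _; apply: definable_prop. Qed.

Lemma definable_and J I (P Q : query J I) : definable P -> definable Q ->
  definable (fun M x y => P M x y /\ Q M x y).
Proof.
move=> dP dQ; have dN := definable_not (definable_imp dP (definable_not dQ)).
apply: definable_ext dN _ => M x y.
by case: (pselect (P M x y)); case: (pselect (Q M x y)); tauto.
Qed.

Lemma definable_forall J I (K : finType) (P : K -> query J I) :
  (forall k, definable (P k)) -> definable (fun M x y => forall k, P k M x y).
Proof.
move=> dP.
suff dr : forall r : seq K,
    definable (fun M x y => forall k, k \in r -> P k M x y).
  apply: definable_ext (dr (enum K)) _ => M x y.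
  by split=> H k; [apply: H; rewrite mem_enum | move=> _; apply: H].
elim=> [|k r IH].
  by apply: definable_ext (definable_prop True) _ => M x y.
apply: definable_ext (definable_and (dP k) IH) _ => M x y; split.
  by move=> [Pk Pr] j; rewrite inE => /orP[/eqP-> | /Pr].
by move=> H; split=> [|j jr]; apply: H; rewrite inE ?eqxx ?jr ?orbT.
Qed.

(** A Boolean combination is the disjunction, over the finitely many truth
    assignments [d] satisfying [F], of the statement that the [Q k] have the
    truth values [d k].  The combination [F] itself may be any function. *)
Lemma definable_bool J I (K : finType) (Q : K -> query J I)
    (F : (K -> Prop) -> Prop) :
  (forall k, definable (Q k)) ->
  definable (fun M x y => F (fun k => Q k M x y)).
Proof.
move=> dQ.
have dE (d : {ffun K -> bool}) :
    definable
      (fun M x y => (forall k, Q k M x y <-> d k) -> ~ F (fun k => d k)).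
  apply: definable_imp; last exact: definable_prop.
  apply: definable_forall => k.
  by apply: definable_and; apply: definable_imp => //; apply: definable_prop.
apply: definable_ext (definable_not (definable_forall dE)) _ => M x y.
have FE (d : {ffun K -> bool}) : (forall k, Q k M x y <-> d k) ->
    (fun k => Q k M x y) = (fun k => d k : Prop).
  by move=> e; apply: funext => k; apply: propext.
split=> [/existsNP [d] /not_implyP [/FE ->] /contrapT // | Fq H].
have e k : Q k M x y <-> [ffun k => `[<Q k M x y>]] k.
  by rewrite ffunE; split=> /asboolP.
by have := H _ e; rewrite -(FE _ e).
Qed.

Lemma definable_ex1 J I (P : query J (option I)) : definable P ->
  definable (fun M x (y : I -> M h) => exists z, P M x (oapp y z)).
Proof.
move=> dP.
suff dA : definable (fun M x (y : I -> M h) => forall z, ~ P M x (oapp y z)).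
  apply: definable_ext (definable_not dA) _ => M x y.
  split=> [/existsNP [z /contrapT Pz]|[z Pz] H]; by [exists z | apply: H Pz].
move=> n c v u.
pose v' j := sval (cid (weaken_term h (v j))).
pose u' i := sval (cid (weaken_term h (u i))).
have [f fE] := fresh_term c h.
have [p pE] := definable_not dP v' (oapp u' f).
exists (fall p) => M a /=.
have E z : (fun j => eval (asg_ext a z) (v' j)) = (fun j => eval a (v j)).
  by apply: funext => j; rewrite /v'; case: cid.
have E' z : (fun i => eval (asg_ext a z) (oapp u' f i)) =
    oapp (fun j => eval a (u j)) z.
  by apply: funext => -[j|] //=; rewrite /u'; case: cid.
by split=> H z; have := H z; rewrite pE E E'.
Qed.

(** The quantifiers are crossed one at a time, splitting the last variable off
    an ordinal-indexed tuple as the [None] of an option. *)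
Lemma definable_ex J (K : finType) (P : query J K) : definable P ->
  definable (I:=void) (fun M x _ => exists y : K -> M h, P M x y).
Proof.
have ord_case : forall n (P : query J 'I_n), definable P ->
    definable (I:=void) (fun M x _ => exists y : 'I_n -> M h, P M x y).
  elim=> [|n IH] {}P dP.
    move=> m c v u.
    have [p pE] := dP _ c v (fun i => of_void _ (ffun0 (card_ord 0) i)).
    exists p => M a; rewrite pE; split=> [Pa|[y]]; first by eexists; exact: Pa.
    by congr P; apply: funext => -[].
  pose Q : query J (option 'I_n) :=
    fun M x y => P M x (fun i => y (unlift ord0 i)).
  have dQ : definable Q by move=> m c v u; apply: dP.
  apply: definable_ext (IH _ (definable_ex1 dQ)) _ => M x _; split.
    by move=> [y [z Pz]]; exists (fun i => oapp y z (unlift ord0 i)).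
  move=> [y Py]; exists (fun i => y (lift ord0 i)), (y ord0).
  rewrite /Q; have -> // : (fun i => oapp (fun i => y (lift ord0 i)) (y ord0)
      (unlift ord0 i)) = y.
  by apply: funext => i; case: unliftP => [j|] ->.
move=> dP.
pose Q : query J 'I_#|K| := fun M x y => P M x (fun k => y (enum_rank k)).
have dQ : definable Q by move=> m c v u; apply: dP.
apply: definable_ext (ord_case _ _ dQ) _ => M x _; split.
  by move=> [y Py]; eexists; exact: Py.
move=> [y Py]; exists (fun i => y (enum_val i)); rewrite /Q.
by have -> : (fun k => y (enum_val (enum_rank k))) = y
  by apply: funext => k; rewrite enum_rankK.
Qed.

Lemma definable_sentence (P : structure L -> Prop) :
  definable (J:=void) (I:=void) (fun M _ _ => P M) ->
  exists phi : sentence L, forall M, holds M phi <-> P M.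
Proof.
move=> /(_ _ (ctx_nil L) (of_void _) (of_void _)) [p pE].
by exists p => M; apply: pE.
Qed.

Lemma definable_sentence_all (P : forall M : structure L, M s -> Prop) :
  definable (J:=unit) (I:=void) (fun M x _ => P M (x tt)) ->
  exists phi : sentence L, forall M, holds M phi <-> forall x, P M x.
Proof.
have [f fE] := fresh_term (ctx_nil L) s.
move=> /(_ _ _ (fun _ => f) (of_void _)) [p pE].
exists (fall p) => M; split=> H x; last by apply/pE; rewrite fE.
by have /pE := H x; rewrite fE.
Qed.

End Queries.

Section QuantifierFree.
Variables (s h : lsort L) (Lr : rel_language).
Variable rel : forall M : structure L, rel_structure Lr (M h).
Arguments rel : clear implicits.
Hypothesis rel_definable : forall (R : Lr) n (c : ctx L n)
    (u : 'I_(ar R) -> term c h), exists phi : formula c,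
  forall (M : structure L) (a : asg M c),
    sat phi a <-> rel M R (fun i => eval a (u i)).

(** In a finite relational language a finite tuple satisfies only finitely many
    atomic conditions, so each property of its quantifier-free type, however it
    is described, is first-order. *)
Lemma definable_qf J (I : finType)
    (F : (I -> I -> Prop) -> rel_structure Lr I -> Prop) :
  definable (s:=s) (J:=J)
    (fun M _ (y : I -> M h) => F (fun i j => y i = y j) (pull (rel M) y)).
Proof.
pose K : finType := ((I * I) + {R : Lr & {ffun 'I_(ar R) -> I}})%type.
pose Q (k : K) : query s h J I := fun M _ y => match k with
  | inl p => y p.1 = y p.2
  | inr (existT R t) => rel M R (fun i => y (t i))
  end.
pose F' (b : K -> Prop) := F (fun i j => b (inl (i, j)))
  (fun R t =>
     b (inr (Tagged (fun R : Lr => {ffun 'I_(ar R) -> I}) (finfun t)))).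
have dQ k : definable (Q k).
  case: k => [[i j]|[R t]] n c v u.
    by exists (feq (u i) (u j)).
  by have [p pE] := rel_definable (fun i => u (t i)); exists p.
apply: definable_ext (definable_bool F' dQ) _ => M x y.
rewrite /F' /Q /=.
have -> // :
  (fun R (t : 'I_(ar R) -> I) => rel M R (fun i => y ((finfun t) i))) =
  pull (rel M) y.
apply: functional_extensionality_dep => R; apply: funext => t.
by congr rel; apply: funext => i; rewrite ffunE.
Qed.

Lemma definable_embedding J (I : finType) (Q : rel_structure Lr I) :
  definable (s:=s) (J:=J) (fun M _ (y : I -> M h) => embedding Q (rel M) y).
Proof.
refine (definable_ext (definable_qf (fun e S =>
  (forall i j, e i j -> i = j) /\ forall R t, Q R t <-> S R t)) _) => M x y.
by [].
Qed.

End QuantifierFree.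

End Definability.

(** * Passing from a class of structures to the models of its theory *)

Definition Th_model (L : language) (C : structure L -> Prop)
    (N : structure L) : Prop :=
  forall phi : sentence L, (forall M, C M -> holds M phi) -> holds N phi.

Section Transfer.
Variables (L : language) (h : lsort L) (Lr : rel_language).
Variable rel : forall M : structure L, rel_structure Lr (M h).
Arguments rel : clear implicits.
Hypothesis rel_definable : forall (R : Lr) n (c : ctx L n)
    (u : 'I_(ar R) -> term c h), exists phi : formula c,
  forall (M : structure L) (a : asg M c),
    sat phi a <-> rel M R (fun i => eval a (u i)).
Variable C : structure L -> Prop.

(** If no structure in [C] had such a tuple, then the sentence saying so would
    belong to the theory of [C]. *)
Lemma transfer_ex (I : finType)
    (P : forall M : structure L, (I -> M h) -> Prop) N :
  definable (s:=h) (J:=void) (fun M _ y => P M y) -> Th_model C N ->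
  (exists y : I -> N h, P N y) -> exists M, C M /\ exists y : I -> M h, P M y.
Proof.
move=> dP tN exP; apply: contrapT => noC.
have [p pE] := definable_sentence (definable_not (definable_ex dP)).
have /pE // : holds N p.
by apply: tN => M CM; apply/pE => exM; apply: noC; exists M.
Qed.

Lemma transfer_all (I : finType)
    (P : forall M : structure L, (I -> M h) -> Prop) N :
  definable (s:=h) (J:=void) (fun M _ y => P M y) -> Th_model C N ->
  (forall M, C M -> forall y : I -> M h, P M y) -> forall y : I -> N h, P N y.
Proof.
move=> dP tN allP y; apply: contrapT => nP.
have [M [CM [z []]]] := transfer_ex (definable_not dP) tN (ex_intro _ y nP).
exact: allP.
Qed.

(** When [P] depends only on the quantifier-free type throughout [C], either
    all tuples of type [Q] satisfy [P] or none does, uniformly over [C].  The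
    one of these two alternatives that holds is a sentence of the theory of
    [C]. *)
Lemma transfer_invariant (I : finType)
    (P : forall M : structure L, (I -> M h) -> Prop) (Q : rel_structure Lr I) :
  definable (s:=h) (J:=void) (fun M _ y => P M y) ->
  (forall M M', C M -> C M' -> forall z z', embedding Q (rel M) z ->
     embedding Q (rel M') z' -> P M z -> P M' z') ->
  forall N N', Th_model C N -> Th_model C N' ->
  forall z z', embedding Q (rel N) z -> embedding Q (rel N') z' ->
  P N z -> P N' z'.
Proof.
move=> dP inv N N' tN tN' z z' ez ez' Pz.
have dQ := definable_embedding (s:=h) (J:=void) rel_definable Q.
have [M [CM [y [ey Py]]]] := transfer_ex (definable_and dQ dP) tN
  (ex_intro _ z (conj ez Pz)).
apply: (transfer_all (definable_imp dQ dP) tN' _ z' ez') => M' CM' y' ey'.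
exact: inv CM CM' _ _ ey ey' Py.
Qed.

(** The extension property is the invariance of the formulas that assert the
    existence of one more point with a prescribed quantifier-free type. *)
Lemma transfer_one_step :
  (forall M M', C M -> C M' -> one_step (rel M) (rel M')) ->
  forall N N', Th_model C N -> Th_model C N' -> one_step (rel N) (rel N').
Proof.
move=> step N N' tN tN' I Q z z' ez ez' x zx.
set Q' := pull (rel N) (oapp z x).
have dP := definable_ex1
  (definable_embedding (s:=h) (J:=void) rel_definable Q').
apply: (transfer_invariant dP _ tN tN' ez ez'); last first.
  by exists x; apply/embedding_pull/oapp_inj => //; case: ez.
move=> M M' CM CM' y y' ey ey' [x0 e0].
have yx0 i : y i <> x0.
  by move=> e; have := proj1 e0 (Some i) None e.
have [x1 e1] := step _ _ CM CM' _ _ _ _ ey ey' _ yx0.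
exists x1; split=> [|R t]; first by case: e1.
by case: e0 => _ /(_ R t) ->; case: e1 => _ /(_ R t) <-.
Qed.

End Transfer.

(** * Models of the theory of a Fraisse limit, and their imaginaries *)

(** A sort of a one-sorted language is an arbitrary element of [unit], which is
    not convertible to [tt] when it is a variable. *)
Definition at_sort (P : unit -> Type) (u : unit) (x : P tt) : P u :=
  match u with tt => x end.

Lemma at_sortP (P : unit -> Type) u (x : P u) : exists y, x = at_sort u y.
Proof. by case: u x => x; exists x. Qed.

Lemma at_sort_eq (P : unit -> Type) u (x y : P tt) :
  at_sort u x = at_sort u y <-> x = y.
Proof. by case: u. Qed.

Lemma eval_at_sort (L : language) (f : unit -> lsort L) n (c : ctx L n) u
    (t : term c (f tt)) (M : structure L) (a : asg M c) :
  eval a (at_sort (P:=fun u => term c (f u)) u t) =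
  at_sort (P:=fun u => M (f u)) u (eval a t).
Proof. by case: u. Qed.

Section Limit.
Variables (L : rel_language) (K : fin_class L).

(** The enlarged finite structure is in the class, hence embeds in the second
    limit; an automorphism then moves this copy onto the given points. *)
Lemma one_step_generic A A' (S : rel_structure L A) (S' : rel_structure L A') :
  generic_model K S -> generic_model K S' -> one_step S S'.
Proof.
move=> [_ _ ageS] [_ homS' ageS'] I Q z z' ez ez' x zx.
have e := embedding_pull S (oapp_inj (proj1 ez) zx).
have /ageS/ageS' [g eg] : in_age S (pull S (oapp z x)) by exists (oapp z x).
have eg' : embedding Q S' (fun i => g (Some i)).
  split=> [i j /(proj1 eg) []//|R t].
  by rewrite -(proj2 eg R (fun i => Some (t i))); case: ez => _ ->.
have [f [/bij_inj injf ef fg]] := homS' _ _ _ _ eg' ez'.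
exists (f (g None)).
have -> : oapp z' (f (g None)) = fun o => f (g o).
  by apply: funext => -[i|] //=.
split=> [i j /injf /(proj1 eg)//|R t].
by rewrite (proj2 eg R t) (proj2 ef R (fun i => g (t i))).
Qed.

Definition home (M : structure (fo_language L)) : rel_structure L (M tt) :=
  fun R x => @rinterp (fo_language L) M R x.
Arguments home : clear implicits.

Lemma home_definable (R : L) n (c : ctx (fo_language L) n)
    (u : 'I_(ar R) -> term c tt) :
  exists phi : formula c, forall (M : structure (fo_language L)) (a : asg M c),
    sat phi a <-> home M R (fun i => eval a (u i)).
Proof. by exists (@Defs.frel (fo_language L) _ c R u). Qed.

Definition generic_structure (M : structure (fo_language L)) : Prop :=
  exists A (S : rel_structure L A), generic_model K S /\ M = fo_structure S.

Lemma models_Th M : models (T_ K) M -> Th_model generic_structure M.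
Proof.
move=> [_ TM] phi gen; apply: TM => A S genS.
by apply: gen; exists A, S.
Qed.

Lemma models_one_step M M' :
  models (T_ K) M -> models (T_ K) M' -> one_step (home M) (home M').
Proof.
move=> /models_Th tM /models_Th tM'.
apply: (transfer_one_step (rel:=home) home_definable _ tM tM').
move=> _ _ [A [S [gS ->]]] [A' [S' [gS' ->]]].
exact: (one_step_generic gS gS').
Qed.

Lemma models_age M (I : finType) (Q : rel_structure L I) z :
  models (T_ K) M -> embedding Q (home M) z -> K Q.
Proof.
move=> /models_Th tM ez.
have dQ := definable_embedding (s:=tt : lsort (fo_language L)) (J:=void)
  (rel:=home) home_definable Q.
have [_ [[A [S [[_ _ ageS] ->]]] [y ey]]] :=
  transfer_ex dQ tM (ex_intro _ z ez).
by apply/ageS; exists y.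
Qed.

(** Quantifier elimination: the type of a finite tuple in a model of [T_ K] is
    determined by the finite structure that the tuple carries. *)
Lemma models_sat M M' (w : world (home M) (home M')) n
    (c : ctx (fo_language L) n) (phi : formula c) (t : 'I_n -> idx w) :
  models (T_ K) M -> models (T_ K) M' ->
  sat phi (fun i => at_sort (P:=M) (c i) (lmap (t i))) <->
  sat phi (fun i => at_sort (P:=M') (c i) (rmap (t i))).
Proof.
move=> tM tM'.
pose rel (v : world (home M) (home M')) (u : lsort (fo_language L)) (x : M u)
    (x' : M' u) := exists i : idx v,
  x = at_sort (P:=M) u (lmap i) /\ x' = at_sort (P:=M') u (rmap i).
have rel_mono v v' : le_world v v' ->
    forall u (x : M u) (x' : M' u), rel v u x x' -> rel v' u x x'.
  by move=> [f [fl fr]] u x x' [i [-> ->]]; exists (f i); rewrite fl fr.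
apply: (@back_and_forth _ _ _ _ rel _ _ _ _ _ _ _ _ w).
- move=> v u x y x' y' [i [-> ->]] [j [-> ->]]; rewrite !at_sort_eq.
  by split=> [/(proj1 (lmap_emb v)) ->|/(proj1 (rmap_emb v)) ->].
- by move=> v [].
- move=> v R x x' /choice [f fE].
  have -> : x = fun i => lmap (f i).
    by apply: functional_extensionality_dep => i; case: (fE i).
  have -> : x' = fun i => rmap (f i).
    by apply: functional_extensionality_dep => i; case: (fE i).
  exact: (iff_trans (iff_sym (proj2 (lmap_emb v) R f))
    (proj2 (rmap_emb v) R f)).
- move=> v u x; have [y ->] := at_sortP (P:=M) x.
  have [v' [vv' [i iy]]] := world_cover (models_one_step tM tM') v y.
  exists v'; split; first exact: rel_mono.
  by exists (at_sort (P:=M') u (rmap i)), i; rewrite iy.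
- move=> v u x; have [y ->] := at_sortP (P:=M') x.
  have [v' [vv' [i iy]]] := world_cover (models_one_step tM' tM) (flip v) y.
  exists (flip v'); split; first exact: (rel_mono _ _ (le_world_flip vv')).
  by exists (at_sort (P:=M) u (rmap i)), i; rewrite -iy.
by move=> i; exists (t i).
Qed.

Local Notation Leq := (eq_language (T_ K)).
Local Notation hsort := (inl tt : lsort Leq).

Definition eq_home (N : structure Leq) : rel_structure L (N hsort) :=
  fun R x => @rinterp Leq N R x.
Arguments eq_home : clear implicits.

Lemma eq_home_definable (R : L) n (c : ctx Leq n)
    (u : 'I_(ar R) -> term c hsort) :
  exists phi : formula c, forall (N : structure Leq) (a : asg N c),
    sat phi a <-> eq_home N R (fun i => eval a (u i)).
Proof. by exists (@Defs.frel Leq _ c R u). Qed.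

Definition rep_arity (s : lsort Leq) : nat :=
  match s with inl _ => 1 | inr E => im_ar E end.

(** Elements of each sort of [T_ K]^eq are named by tuples from the home sort:
    an element of a home sort by itself, an imaginary by any representative of
    its class.  This puts all sorts on the same footing. *)
Definition rep (N : structure Leq) (s : lsort Leq) :
    ('I_(rep_arity s) -> N hsort) -> N s :=
  match s with
  | inl u => fun y => at_sort (P:=fun u => N (inl u)) u (y ord0)
  | inr E => fun y => @finterp Leq N (inr E)
      (fun i => at_sort (P:=fun u => N (inl u)) (im_ctx i) (y i))
  end.

Lemma rep_term n (c : ctx Leq n) s (u : 'I_(rep_arity s) -> term c hsort) :
  exists t : term c s, forall (N : structure Leq) (a : asg N c),
    eval a t = rep (fun i => eval a (u i)).
Proof.
case: s u => [v|E] u.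
  exists (at_sort (P:=fun v => term c (inl v : lsort Leq)) v (u ord0)) => N a.
  exact: (eval_at_sort (f:=fun v => inl v : lsort Leq)).
exists (@tapp Leq _ c (inr E)
  (fun i => at_sort (P:=fun v => term c (inl v : lsort Leq)) (im_ctx i) (u i))).
move=> N a /=; congr (@finterp Leq N (inr E)).
apply: functional_extensionality_dep => i.
exact: (eval_at_sort (f:=fun v => inl v : lsort Leq)).
Qed.

Definition eq_of_model (N : structure Leq) : Prop :=
  exists M, models (T_ K) M /\ N = eq_structure (T_ K) M.

Lemma eq_models_Th N : models (eq_theory (T_ K)) N -> Th_model eq_of_model N.
Proof.
move=> [_ TN] phi gen; apply: TN => M TM.
by apply: gen; exists M.
Qed.

Lemma eq_one_step N N' : models (eq_theory (T_ K)) N ->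
  models (eq_theory (T_ K)) N' -> one_step (eq_home N) (eq_home N').
Proof.
move=> /eq_models_Th tN /eq_models_Th tN'.
apply: (transfer_one_step (rel:=eq_home) eq_home_definable _ tN tN').
move=> _ _ [M [tM ->]] [M' [tM' ->]].
exact: (models_one_step tM tM').
Qed.

Lemma eq_age N (I : finType) (Q : rel_structure L I) z :
  models (eq_theory (T_ K)) N -> embedding Q (eq_home N) z -> K Q.
Proof.
move=> /eq_models_Th tN ez.
have dQ := definable_embedding (s:=hsort) (J:=void) (rel:=eq_home)
  eq_home_definable Q.
have [_ [[M [tM ->]] [y ey]]] := transfer_ex dQ tN (ex_intro _ z ez).
exact: (models_age tM ey).
Qed.

Lemma im_class_eq (M : structure (fo_language L)) (E : imaginary (T_ K))
    (a b : asg M (@im_ctx _ _ E)) : models (T_ K) M ->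
  im_class a = im_class b <-> sat (im_rel E) (asg_cat a b).
Proof.
move=> tM; have [Erefl Esym Etrans] := im_equiv E tM.
split=> [ab|ab]; first by have : im_class b b by []; rewrite -ab.
apply/predeqP => d; split; last exact: Etrans.
by apply: Etrans; apply: Esym.
Qed.

Lemma rep_eqP M E (y1 y2 : 'I_(im_ar E) -> eq_structure (T_ K) M hsort) :
  models (T_ K) M ->
  rep (s:=inr E) y1 = rep (s:=inr E) y2 <->
  sat (im_rel E) (asg_cat (fun i => at_sort (P:=M) (@im_ctx _ _ E i) (y1 i))
                          (fun i => at_sort (P:=M) (@im_ctx _ _ E i) (y2 i))).
Proof.
move=> tM; rewrite -im_class_eq //; split=> [/(congr1 sval) //|e].
exact: eq_exist.
Qed.

(** Surjectivity of the projection onto an imaginary sort is a sentence true in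
    each M^eq; a model of [T_ K]^eq need not be of that form, so the sentence
    has to be transferred. *)
Lemma rep_surj N : models (eq_theory (T_ K)) N ->
  forall s (x : N s), exists y, x = rep y.
Proof.
move=> /eq_models_Th tN [u|E] x.
  by have [y ->] := at_sortP (P:=fun u => N (inl u)) x; exists (fun _ => y).
pose P (N : structure Leq) (x : N (inr E)) := exists y, x = rep (s:=inr E) y.
have dP : definable (s:=inr E : lsort Leq) (h:=hsort) (J:=unit)
    (I:='I_(im_ar E))
    (fun N (x : unit -> N (inr E)) y => x tt = rep (s:=inr E) y).
  move=> n c v u; have [t tE] := @rep_term n c (inr E) u.
  by exists (feq (v tt) t) => N0 a /=; rewrite tE.
have [p pE] := definable_sentence_all (P:=P) (definable_ex dP).
have /pE/(_ x) // : holds N p.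
apply: tN => _ [M [tM ->]]; apply/pE => -[X [a aX]].
have /choice [y yE] : forall i,
    exists y, a i = at_sort (P:=M) (@im_ctx _ _ E i) y.
  by move=> i; apply: at_sortP.
exists y; apply: eq_exist; rewrite aX; congr im_class.
exact: functional_extensionality_dep.
Qed.

(** Two tuples name the same imaginary exactly when the defining formula holds
    of them, and by [models_sat] this depends on their quantifier-free type
    only. *)
Lemma rep_eq N N' (w : world (eq_home N) (eq_home N')) s
    (t1 t2 : 'I_(rep_arity s) -> idx w) :
  models (eq_theory (T_ K)) N -> models (eq_theory (T_ K)) N' ->
  rep (fun i => lmap (t1 i)) = rep (fun i => lmap (t2 i)) ->
  rep (fun i => rmap (t1 i)) = rep (fun i => rmap (t2 i)).
Proof.
move=> /eq_models_Th tN /eq_models_Th tN'.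
case: s t1 t2 => [u|E] t1 t2.
  by rewrite !at_sort_eq => /(proj1 (lmap_emb w)) ->.
pose P (N : structure Leq) (y : idx w -> N hsort) :=
  rep (s:=inr E) (fun i => y (t1 i)) = rep (s:=inr E) (fun i => y (t2 i)).
have dP : definable (s:=hsort) (J:=void) (fun N _ y => P N y).
  move=> n c v u.
  have [q1 q1E] := @rep_term n c (inr E) (fun i => u (t1 i)).
  have [q2 q2E] := @rep_term n c (inr E) (fun i => u (t2 i)).
  by exists (feq q1 q2) => N0 a /=; rewrite q1E q2E.
apply: (transfer_invariant (rel:=eq_home) eq_home_definable dP _ tN tN'
  (lmap_emb w) (rmap_emb w)).
move=> _ _ [M [tM ->]] [M' [tM' ->]] z z' ez ez'.
rewrite /P !rep_eqP //.
set v : world (home M) (home M') := World ez ez'.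
have catE (A : structure (fo_language L)) (y : idx w -> A tt) :
    asg_cat (fun i => at_sort (P:=A) (@im_ctx _ _ E i) (y (t1 i)))
            (fun i => at_sort (P:=A) (@im_ctx _ _ E i) (y (t2 i))) =
    (fun i => at_sort (P:=A) (ctx_cat (@im_ctx _ _ E) (@im_ctx _ _ E) i)
       (y (match fintype.split i with inl j => t1 j | inr j => t2 j end))).
  apply: functional_extensionality_dep => i; rewrite /asg_cat /ctx_cat.
  by case: (fintype.split i).
by rewrite !catE => /(models_sat (w:=v)) h; apply/h.
Qed.

Definition eq_rel N N' (w : world (eq_home N) (eq_home N')) (s : lsort Leq)
    (x : N s) (x' : N' s) : Prop :=
  exists t : 'I_(rep_arity s) -> idx w,
    x = rep (fun i => lmap (t i)) /\ x' = rep (fun i => rmap (t i)).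

(** The type of a tuple of imaginaries is determined by the finite structure
    carried by representatives of its entries. *)
Lemma eq_sat N N' (w : world (eq_home N) (eq_home N')) n
    (c : ctx Leq n) (phi : formula c) (a : asg N c) (a' : asg N' c) :
  models (eq_theory (T_ K)) N -> models (eq_theory (T_ K)) N' ->
  (forall i, eq_rel w (a i) (a' i)) -> sat phi a <-> sat phi a'.
Proof.
move=> tN tN'.
have rel_mono (v v' : world (eq_home N) (eq_home N')) : le_world v v' ->
    forall s (x : N s) (x' : N' s), eq_rel v x x' -> eq_rel v' x x'.
  move=> [f [fl fr]] s x x' [t [-> ->]]; exists (fun i => f (t i)).
  by split; congr rep; apply: funext => i.
apply: (@back_and_forth _ _ _ _ (@eq_rel N N') _ _ _ _ _ _ _ _ w).
- move=> v s x y x' y' [t1 [-> ->]] [t2 [-> ->]]; split; first exact: rep_eq.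
  exact: (rep_eq (w:=flip v)).
- move=> v [[]|E] x x' xx'.
  have /choice [f fE] : forall i : 'I_(im_ar E), exists j : idx v,
      x i = at_sort (P:=fun u => N (inl u)) (im_ctx i) (lmap j) /\
      x' i = at_sort (P:=fun u => N' (inl u)) (im_ctx i) (rmap j).
    by move=> i; have [t tE] := xx' i; exists (t ord0).
  exists f; split; congr (@finterp Leq _ (inr E));
  by apply: functional_extensionality_dep => i; case: (fE i).
- move=> v R x x' xx'.
  have /choice [f fE] : forall i : 'I_(ar R), exists j : idx v,
      x i = lmap j /\ x' i = rmap j.
    by move=> i; have [t tE] := xx' i; exists (t ord0).
  have -> : x = fun i => lmap (f i).
    by apply: functional_extensionality_dep => i; case: (fE i).
  have -> : x' = fun i => rmap (f i).
    by apply: functional_extensionality_dep => i; case: (fE i).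
  exact: (iff_trans (iff_sym (proj2 (lmap_emb v) R f))
    (proj2 (rmap_emb v) R f)).
- move=> v s x; have [y ->] := rep_surj tN x.
  have [v' [vv' [t ty]]] := world_covers (eq_one_step tN tN') v y.
  exists v'; split; first exact: rel_mono.
  exists (rep (fun i => rmap (t i))), t; split=> //.
  by congr rep; apply: funext => i.
- move=> v s x; have [y ->] := rep_surj tN' x.
  have [v' [vv' [t ty]]] := world_covers (eq_one_step tN' tN) (flip v) y.
  exists (flip v'); split; first exact: (rel_mono _ _ (le_world_flip vv')).
  exists (rep (fun i => rmap (t i))), t; split=> //.
  by congr rep; apply: funext => i; rewrite -ty.
Qed.

End Limit.

(** * A generic society on the natural numbers *)

(** A symmetric relation sees only the set of entries of an injective tuple. *)
Lemma sym_range n A (T : ('I_n -> A) -> Prop) (t t' : 'I_n -> A) :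
  symmetric_rel T -> T t -> injective t' -> (forall i, exists j, t j = t' i) ->
  T t'.
Proof.
move=> symT Tt inj' /choice [f fE].
have injf : injective f by move=> i j e; apply: inj'; rewrite -!fE e.
have := symT t (perm injf) Tt; congr T; apply: funext => i.
by rewrite permE fE.
Qed.

Lemma injective_unbounded (f : nat -> nat) N :
  injective f -> exists j, (N < f j)%N.
Proof.
move=> injf; apply: contrapT => /forallNP nf.
have /uniq_leq_size : uniq [seq f j | j <- iota 0 N.+2].
  by rewrite map_inj_uniq ?iota_uniq.
move=> /(_ (iota 0 N.+1)); rewrite size_map !size_iota ltnn => /(_ _)/notF.
apply=> _ /mapP[j _ ->]; rewrite mem_iota /= add0n ltnS leqNgt.
exact/negP/nf.
Qed.

Section Random.
Variable L : rel_language.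
Local Open Scope fset_scope.

(** Every natural number codes a finite list of prescribed edges.  The first
    component of the coded pair varies freely, which gives infinitely many codes
    for each list, hence arbitrarily large ones. *)
Definition ties (v : nat) : seq (L * {fset nat}) :=
  if @choice.unpickle (nat * seq (L * {fset nat}))%type v is Some (_, q)
  then q else [::].

Lemma ties_exist (P : L -> {fset nat} -> Prop) (F : {fset nat}) :
  exists v, (forall u, u \in F -> (u < v)%N) /\
    forall R s, s `<=` F -> ((R, s) \in ties v <-> P R s).
Proof.
pose q := [seq p <- [seq (R, s) | R <- enum L, s <- enum_fset (fpowerset F)]
          | `[<P p.1 p.2>]].
have [j Nj] := @injective_unbounded
  (fun j => choice.pickle (j, q)) (\max_(u <- F) u) (fun i j e =>
     congr1 fst (pcan_inj choice.pickleK e)).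
exists (choice.pickle (j, q)); split.
  by move=> u uF; apply: leq_ltn_trans Nj; apply: leq_bigmax_seq.
move=> R s sF; rewrite /ties choice.pickleK mem_filter /=.
split=> [/andP[/asboolP]//|/asboolP -> /=].
by apply: allpairs_f; rewrite ?mem_enum // fpowersetE.
Qed.

(** Whether a finite set is an edge is decided by its largest element alone, so
    a new vertex above finitely many old ones can be given an arbitrary
    neighbourhood among them. *)
Definition edge (R : L) (s : {fset nat}) : Prop :=
  exists2 v, v \in s &
    (forall u, u \in s -> (u <= v)%N) /\ (R, s `\ v) \in ties v.

Definition range_fset n (w : 'I_n -> nat) : {fset nat} := [fset x in codom w].

Lemma in_range_fset n (w : 'I_n -> nat) x :
  x \in range_fset w <-> exists i, w i = x.
Proof.
rewrite inE /=; split=> [/codomP [i ->]|[i <-]]; first by exists i.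
exact: codom_f.
Qed.

Definition random : rel_structure L nat :=
  fun R w => injective w /\ edge R (range_fset w).

Lemma random_irr R : irreflexive_rel (@random R).
Proof. by move=> w []. Qed.

Lemma random_sym R : symmetric_rel (@random R).
Proof.
move=> w p [injw ew]; split; first by move=> i j /injw /perm_inj.
have -> // : range_fset (fun i => w (p i)) = range_fset w.
apply/fsetP => x; apply/idP/idP => /in_range_fset [i <-]; apply/in_range_fset.
  by exists (p i).
by exists ((p^-1)%g i); rewrite permKV.
Qed.

Lemma edge_top R v (s : {fset nat}) :
  v \in s -> (forall u, u \in s -> u != v -> (u < v)%N) ->
  edge R s <-> (R, s `\ v) \in ties v.
Proof.
move=> vs sv.
have le u : u \in s -> (u <= v)%N.
  by move=> us; case: (eqVneq u v) => [->//|/(sv _ us)/ltnW].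
split=> [[u us [us' eu]]|ev]; last by exists v.
have -> // : v = u by apply/eqP; rewrite eqn_leq le // us'.
Qed.

Definition partial_emb (B : finType) (S : rel_structure L B) (s : seq B)
    (z : B -> nat) : Prop :=
  {in s &, injective z} /\
  forall R (t : 'I_(ar R) -> B), (forall i, t i \in s) ->
    (S R t <-> random (fun i => z (t i))).

(** The image of [b] is a number [v] above all the earlier values whose list
    [ties v] prescribes exactly the edges that [S] puts through [b]. *)
Lemma partial_emb_extend (B : finType) (S : rel_structure L B) s z b :
  S_ L B S -> partial_emb S s z -> b \notin s ->
  exists v, partial_emb S (b :: s) (fun x => if x == b then v else z x).
Proof.
move=> socS [injz relz] bs.
pose F : {fset nat} := [fset x in map z s].
pose P (R : L) (f : {fset nat}) := exists t : 'I_(ar R) -> B, S R t /\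
  forall x, (exists i, t i = x) <-> (x = b \/ (x \in s /\ z x \in f)).
have [v [vF vP]] := ties_exist P F; exists v.
set z' := fun x => _.
have zF x : x \in s -> (z x < v)%N by move=> xs; apply: vF; rewrite inE map_f.
have z'b : z' b = v by rewrite /z' eqxx.
have z's x : x \in s -> z' x = z x.
  by move=> xs; rewrite /z'; case: eqP => // e; rewrite -e xs in bs.
have injz' : {in b :: s &, injective z'}.
  move=> x y; rewrite !inE => /orP[/eqP->|xs] /orP[/eqP->|ys] //.
  - by rewrite z'b z's // => e; have := zF _ ys; rewrite e ltnn.
  - by rewrite z'b z's // => e; have := zF _ xs; rewrite e ltnn.
  - by rewrite !z's //; apply: injz.
split=> // R t tbs.
case: (pselect (exists i, t i = b)) => [[i0 ti0]|/forallNP tb]; last first.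
  have ts i : t i \in s.
    by have := tbs i; rewrite inE => /orP[/eqP /tb//|].
  by rewrite relz //; under eq_fun do rewrite -z's //.
have [irrS symS] := socS R.
case: (pselect (injective t)) => [injt|ninj]; last first.
  by split=> [/irrS//|[inj _]]; case: ninj => i j e; apply: inj; rewrite e.
have injw : injective (fun i => z' (t i)).
  by move=> i j /injz' e; apply: injt; apply: e.
set w := fun i => _ in injw *.
have vw : v \in range_fset w by apply/in_range_fset; exists i0; rewrite /w ti0.
have wv u : u \in range_fset w -> u != v -> u \in F.
  move=> /in_range_fset [i <-]; rewrite /w => nv.
  have := tbs i; rewrite inE => /orP[/eqP e|ts].
    by rewrite e z'b eqxx in nv.
  by rewrite z's // inE map_f.
have -> : random w <-> edge R (range_fset w) by split=> [[]|].
rewrite (edge_top R vw) => [|u uw uv]; last exact/vF/wv.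
have -> : (R, range_fset w `\ v) \in ties v <-> P R (range_fset w `\ v).
  by apply: vP; apply/fsubsetP => u; rewrite in_fsetD1 => /andP[uv /wv]; apply.
have rangeE x : (exists i, t i = x) <->
    (x = b \/ (x \in s /\ z x \in range_fset w `\ v)).
  split=> [[i <-]|[->|[xs]]]; last 2 first.
  - by exists i0.
  - rewrite in_fsetD1 => /andP[zv /in_range_fset [i wi]]; exists i.
    apply: injz' => //; first by rewrite inE xs orbT.
    by rewrite (z's _ xs); apply: wi.
  have := tbs i; rewrite inE => /orP[/eqP|ts]; first by left.
  right; split=> //; rewrite in_fsetD1 (ltn_eqF (zF _ ts)) /=.
  by apply/in_range_fset; exists i; rewrite /w z's.
split=> [St|[t1 [St1 t1E]]]; first by exists t.
apply: (sym_range symS St1 injt) => i.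
by apply/t1E/rangeE; exists i.
Qed.

Lemma random_one_step : one_step random random.
Proof.
move=> I Q z z' ez ez' x zx.
set S := pull random (oapp z x).
have injo := oapp_inj (proj1 ez) zx.
have socS : S_ L (option I) S.
  move=> R; split=> [t /random_irr inj i j e|t p]; last exact: random_sym.
  by apply: inj; rewrite e.
have emb0 : partial_emb S [seq Some i | i <- enum I] (oapp z' 0).
  split=> [_ _ /mapP[i _ ->] /mapP[j _ ->] /= /(proj1 ez') -> //|R t ts].
  have /choice [f fE] : forall k, exists i, t k = Some i.
    by move=> k; case/mapP: (ts k) => i; exists i.
  have -> : t = fun k => Some (f k) by apply: funext.
  exact: (iff_trans (iff_sym (proj2 ez R f)) (proj2 ez' R f)).
have [|v [injv relv]] := partial_emb_extend (b:=None) socS emb0.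
  by apply/mapP => -[].
have inN o : o \in None :: [seq Some i | i <- enum I].
  by case: o => [i|] //; rewrite inE map_f // mem_enum.
exists v; have -> : oapp z' v = fun o => if o == None then v else oapp z' 0 o.
  by apply: funext => -[].
by split=> [o o' /injv|R t]; [apply | apply: relv].
Qed.

Lemma random_age (ar_gt0 : forall R : L, (0 < ar R)%N) (B : finType)
    (S : rel_structure L B) :
  S_ L B S <-> in_age random S.
Proof.
split=> [socS|[z [injz relz]] R]; last first.
  split=> [t /relz /random_irr inj i j e|t p /relz h].
    by apply: inj; rewrite e.
  by apply/relz; apply: (random_sym p h).
suff [z [injz relz]] : exists z, partial_emb S (enum B) z.
  exists z; split=> [x y|R t]; first by apply: injz; rewrite mem_enum.
  by apply: relz => i; rewrite mem_enum.
elim: (enum B) => [|b s [z zs]].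
  by exists (fun _ => 0); split=> // R t /(_ (Ordinal (ar_gt0 R))).
case: (boolP (b \in s)) => bs; last first.
  have [v vs] := partial_emb_extend socS zs bs.
  by exists (fun x => if x == b then v else z x).
have sE x : (x \in b :: s) = (x \in s).
  by rewrite inE; case: eqP => // ->.
case: zs => injz relz; exists z; split=> [x y|R t ts].
  by rewrite !sE; apply: injz.
by apply: relz => i; rewrite -sE.
Qed.

(** A vertex above [F] whose list of prescribed edges mentions no subset of
    [F]. *)
Lemma random_isolated (F : {fset nat}) : exists2 v, v \notin F &
  forall R (w : 'I_(ar R) -> nat), (forall i, w i = v \/ w i \in F) ->
  (exists i, w i = v) -> ~ random w.
Proof.
have [v [vF vP]] := ties_exist (fun _ _ => False) F.
exists v; first by apply/negP => /vF; rewrite ltnn.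
move=> R w wF [i wi] [_].
have vw : v \in range_fset w by apply/in_range_fset; exists i.
have wF' u : u \in range_fset w -> u != v -> u \in F.
  by move=> /in_range_fset [j <-]; case: (wF j) => [->|//]; rewrite eqxx.
rewrite (edge_top R vw) => [|u uw uv]; last exact/vF/wF'.
move/vP; apply; apply/fsubsetP => u.
by rewrite in_fsetD1 => /andP[uv /wF']; apply.
Qed.

End Random.

(** The union of an increasing sequence of finite partial isomorphisms [W n],
    where [W n.+1] has [n] both in its domain and in its range. *)
Lemma one_step_homogeneous (L : rel_language) (S : rel_structure L nat) :
  one_step S S -> ultrahomogeneous S.
Proof.
move=> step B Q f g ef eg.
have /choice [next nextP] : forall p : world S S * nat, exists v : world S S,
    [/\ le_world p.1 v, exists i : idx v, lmap i = p.2
      & exists i : idx v, rmap i = p.2].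
  move=> [w n] /=.
  have [v [wv [i iv]]] := world_cover step w n.
  have [u [vu iu]] := world_cover step (flip v) n.
  exists (flip u); split=> //.
    by apply: le_world_trans wv _; apply: (le_world_flip vu).
  by have [k [kl kr]] := vu; exists (k i); rewrite -iv; apply: kr.
pose W := fix W n := if n is m.+1 then next (W m, m) else World ef eg.
have leW m n : (m <= n)%N -> le_world (W m) (W n).
  elim: n => [|n IH]; first by rewrite leqn0 => /eqP->; apply: le_world_refl.
  rewrite leq_eqVlt => /orP[/eqP->|/IH h]; first exact: le_world_refl.
  by apply: le_world_trans h _; have [] := nextP (W n, n).
pose H x y := exists n (i : idx (W n)), lmap i = x /\ rmap i = y.
have Hl x : exists y, H x y.
  have [_ [i ix] _] := nextP (W x, x).
  by exists (rmap i), x.+1, i.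
have Hr y : exists x, H x y.
  have [_ _ [i iy]] := nextP (W y, y).
  by exists (lmap i), y.+1, i.
have common (K : finType) (x y : K -> nat) : (forall k, H (x k) (y k)) ->
    exists n (t : K -> idx (W n)),
      (forall k, lmap (t k) = x k) /\ (forall k, rmap (t k) = y k).
  move=> /choice [m mH]; pose n := \max_k m k.
  have /choice [t tE] : forall k,
      exists i : idx (W n), lmap i = x k /\ rmap i = y k.
    move=> k; have [i [ix iy]] := mH k.
    have [j [jl jr]] := leW _ _ (leq_bigmax (F:=m) k).
    by exists (j i); rewrite jl jr.
  by exists n, t; split=> k; case: (tE k).
have /choice [h hH] := Hl.
have emb : embedding S S h.
  split=> [x y e|R x].
    have [n [t [tx ty]]] := common bool (fun b => if b then x else y) _
      (fun b => hH _).
    have : t true = t false by apply: (proj1 (rmap_emb (W n))); rewrite !ty.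
    by move/(congr1 (@lmap _ _ _ _ _ _)); rewrite !tx.
  have [n [t [tx ty]]] := common _ x _ (fun k => hH _).
  have := proj2 (lmap_emb (W n)) R t; have := proj2 (rmap_emb (W n)) R t.
  have -> : (fun i => lmap (t i)) = x by apply: funext.
  have -> : (fun i => rmap (t i)) = (fun i => h (x i)) by apply: funext.
  by move=> <- <-.
have uniq_r x y y' : H x y -> H x y' -> y = y'.
  move=> Hy Hy'.
  have [n [t [tx ty]]] :=
    common bool (fun _ => x) (fun b => if b then y else y')
      (fun b => if b as b return H x (if b then y else y') then Hy else Hy').
  have : t true = t false by apply: (proj1 (lmap_emb (W n))); rewrite !tx.
  by move/(congr1 (@rmap _ _ _ _ _ _)); rewrite !ty.
exists h; split=> //.
  have /choice [k kH] := Hr.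
  exists k => [x|y]; last exact: uniq_r (hH _) (kH _).
  by apply: (proj1 emb); apply: uniq_r (hH _) (kH _).
by move=> b; apply: uniq_r (hH _) _; exists 0, b.
Qed.

Lemma random_generic (L : rel_language) :
  (forall R : L, (0 < ar R)%N) -> generic_model (S_ L) (@random L).
Proof.
move=> ar_gt0; split; first exact: countableP.
  exact/one_step_homogeneous/random_one_step.
by move=> B S; apply: random_age.
Qed.

(** * Sorts of tuples *)

Section Tuples.
Variables (L : rel_language) (K : fin_class L) (V : finType).
Local Notation Leq := (eq_language (T_ K)).
Local Notation hsort := (inl tt : lsort Leq).

Local Notation c := (@ctx_const (fo_language L) #|V| tt).

Lemma tuple_eq_formula :
  exists phi : formula (ctx_cat c c),
    forall (M : structure (fo_language L)) (a b : asg M c),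
      sat phi (asg_cat a b) <-> a = b.
Proof.
have d : definable (s:=tt : lsort (fo_language L))
    (h:=tt : lsort (fo_language L)) (J:=void) (I:=('I_#|V| + 'I_#|V|)%type)
    (fun M _ y => forall i, y (inl i) = y (inr i)).
  by apply: definable_forall => i n d v u; exists (feq (u (inl i)) (u (inr i))).
have [p pE] := d _ (ctx_cat c c) (of_void _) (fun u => match u with
  | inl i => sval (cid (left_term c c i))
  | inr i => sval (cid (right_term c c i))
  end).
exists p => M a b; apply: (iff_trans (pE _ _)).
split=> [h|<- i]; last first.
  by case: cid => t tE; case: cid => t' t'E /=; rewrite tE t'E.
apply: functional_extensionality_dep => i; have := h i.
by case: cid => t tE; case: cid => t' t'E /=; rewrite tE t'E.
Qed.

Lemma tuple_eq_equiv (M : structure (fo_language L)) : models (T_ K) M ->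
  defines_equivalence M (sval (cid tuple_eq_formula)).
Proof.
by move=> _; case: cid => p pE; split=> [a|a b|a b d] /=; rewrite !pE // => ->.
Qed.

(** The imaginary sort of the trivial equivalence relation, equality of
    [V]-indexed tuples: its elements are the tuples themselves. *)
Definition tuple_sort : lsort Leq := inr (Imaginary tuple_eq_equiv).

Definition tuple (N : structure Leq) (y : V -> N hsort) : N tuple_sort :=
  rep (s:=tuple_sort) (fun i => y (enum_val i)).

Lemma tuple_inj (M : structure (fo_language L)) : models (T_ K) M ->
  injective (@tuple (eq_structure (T_ K) M)).
Proof.
move=> tM y1 y2 /(rep_eqP (E:=Imaginary tuple_eq_equiv) _ _ tM) /=.
case: cid => p pE /= /pE e; apply: funext => v.
by rewrite -(enum_rankK v); apply: (congr1 (fun a => a (enum_rank v)) e).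
Qed.

(** The language has no coordinate functions on a sort of tuples.  The formula
    therefore guesses the coordinates, checks by projecting that the guess is
    right, and evaluates [F] on them. *)
Lemma coordinate_formula l (I := ('I_l * V)%type : finType)
    (F : (I -> I -> Prop) -> rel_structure L I -> Prop) :
  exists phi : formula (ctx_const l tuple_sort),
  forall (M : structure (fo_language L)), models (T_ K) M ->
  forall y : I -> M tt,
    sat (M:=eq_structure (T_ K) M) phi
      (fun j => @tuple (eq_structure (T_ K) M) (fun v => y (j, v))) <->
    F (fun p q => y p = y q) (pull (@home L M) y).
Proof.
have d1 (j : 'I_l) : definable (s:=tuple_sort) (h:=hsort) (J:='I_l) (I:=I)
    (fun N x y => x j = tuple (fun v => y (j, v))).
  move=> n d v u.
  have [t tE] := @rep_term L K n d tuple_sort (fun i => u (j, enum_val i)).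
  by exists (feq (v j) t) => N a /=; rewrite tE.
have d2 := definable_qf (s:=tuple_sort) (rel:=@eq_home L K)
  (@eq_home_definable L K) (J:='I_l) F.
have [p pE] := definable_ex (definable_and (definable_forall d1) d2)
  (fun i => tvar (ctx_const l tuple_sort) i) (of_void _).
exists p => M tM y; apply: (iff_trans (pE _ _)); split; last by exists y.
move=> [y' [yy']].
have -> // : y' = y.
apply: funext => -[j v]; have /= /(tuple_inj tM) e := yy' j.
by rewrite (congr1 (fun f => f v) e).
Qed.

End Tuples.

(** * Tuples with a private coordinate are independent *)

Lemma random_models (L : rel_language) : (forall R : L, (0 < ar R)%N) ->
  models (T_ (S_ L)) (fo_structure (@random L)).
Proof.
move=> ar_gt0; split=> [s|phi]; first exact: (inhabits 0).
by apply; apply: random_generic.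
Qed.

Lemma eq_structure_models (L : rel_language) (K : fin_class L) M :
  models (T_ K) M -> models (eq_theory (T_ K)) (eq_structure (T_ K) M).
Proof.
move=> tM; split=> [s|phi]; last by apply.
have [x] := tM.1 tt.
exact: inhabits (rep (N:=eq_structure (T_ K) M) (s:=s) (fun _ => x)).
Qed.

Section Fresh.
Variables (L : rel_language) (ar_gt0 : forall R : L, (0 < ar R)%N).
Variables (U B V : finType) (Q : rel_structure L (U + B)%type).
Variables (g : (U + B)%type -> nat) (q : B -> V -> U).
Hypothesis g_emb : embedding Q (@random L) g.
Hypothesis Q_isolated : forall R (x : 'I_(ar R) -> (U + B)%type) b,
  (exists i, x i = inr b) -> ~ Q x.

Let N := eq_structure (T_ (S_ L)) (fo_structure (@random L)).

Let point (f : (U + B)%type -> nat) b (v : option V) :=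
  if v is Some v then f (inl (q b v)) else f (inr b).

(** The coordinate [None] holds the private vertex [inr b], the others hold
    vertices that may be shared with other elements of [B]. *)
Definition fresh_tuple (b : B) : N (tuple_sort (S_ L) (option V)) :=
  tuple (N:=N) (point g b).

(** Let [b] lie outside [B0].  The vertex [inr b] occurs in no tuple with index
    in [B0] and lies on no edge among the vertices used, so it can be replaced
    by any of infinitely many isolated vertices without changing the type of the
    whole family over the tuples with index in [B0].  A formula satisfied by the
    family over these parameters hence has infinitely many realizations. *)
Lemma fresh_in_F : in_F (eq_theory (T_ (S_ L))) fresh_tuple.
Proof.
have tG := random_models ar_gt0.
have tN := eq_structure_models tG.
split=> // [b b' /(tuple_inj tG) e|B0 /properP [_ [b _ bB0]]].
  by have /(proj1 g_emb) [] := congr1 (fun f => f None) e.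
move=> [m [p [phi [pB0 Da finD]]]].
have /choice [be beE] : forall j, exists b', b' \in B0 /\ p j = fresh_tuple b'.
  by move=> j; have [b' /= b'B0 <-] := pB0 j; exists b'.
have /choice [nu nuE] : forall X : N (tuple_sort (S_ L) (option V)),
    exists v : nat, forall y, X = tuple (N:=N) y -> y None = v.
  move=> X.
  case: (pselect (exists y, X = tuple (N:=N) y)) => [[y ->]|/forallNP nX].
    by exists (y None) => y' /(tuple_inj tG) ->.
  by exists 0 => y /nX.
(* [F] collects the private vertices at [b] of the finitely many realizations;
   a vertex [v] isolated from and outside [F] yields one more realization. *)
have /finite_fsetP [F FE] := finite_image (fun x => nu (x (enum_rank b))) finD.
have [v vF iso] := random_isolated L
  (F `|` [fset x in map g (enum {: U + B})])%fset.
have vg u : v != g u.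
  apply: contra vF => /eqP->; rewrite in_fsetU inE /= map_f ?orbT //.
  by rewrite mem_enum.
pose g' u := if u == inr b then v else g u.
have g'_emb : embedding Q (@random L) g'.
  split=> [u u'|R x].
    rewrite /g'; case: eqP => [->|_]; case: eqP => [->|_] // e.
    - by have := vg u'; rewrite e eqxx.
    - by have := vg u; rewrite e eqxx.
    - exact: (proj1 g_emb).
  case: (pselect (exists i, x i = inr b)) => [xb|/forallNP xb].
    split=> [/(Q_isolated xb)//|]; have [i xi] := xb.
    suff : ~ random (fun i => g' (x i)) by [].
    apply: iso; last by exists i; rewrite /g' xi eqxx.
    move=> j; rewrite /g'; case: eqP => _; [by left | right].
    by rewrite in_fsetU inE /= map_f ?orbT // mem_enum.
  have -> : (fun i => g' (x i)) = (fun i => g (x i)).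
    by apply: funext => i; rewrite /g'; case: eqP => // /xb.
  exact: (proj2 g_emb).
pose w : world (@eq_home L (S_ L) N) (@eq_home L (S_ L) N) :=
  World g_emb g'_emb.
have rel_point b' : eq_rel w (fresh_tuple b') (tuple (N:=N) (point g' b')).
  exists (fun i => if enum_val i is Some v then inl (q b' v) else inr b').
  by split; congr (rep (s:=tuple_sort _ _)); apply: funext => i;
    rewrite /point; case: (enum_val i).
pose x' (i : 'I_#|B|) := tuple (N:=N) (point g' (enum_val i)).
suff Dx' : sat phi (@asg_cat _ N _ _ (ctx_const _ _) (ctx_const _ _) x' p).
  have : [set` F]%classic (nu (x' (enum_rank b))) by rewrite -FE; exists x'.
  rewrite -(nuE _ _ erefl) /= enum_rankK /g' eqxx => vF'.
  by move: vF; rewrite in_fsetU vF'.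
have rel_p j : eq_rel w (p j) (p j).
  have [beB0 pE] := beE j.
  have {2}-> : p j = tuple (N:=N) (point g' (be j)); last by rewrite pE.
  rewrite pE /fresh_tuple; congr tuple; apply: funext => -[u|] //=.
  rewrite /g'; case: eqP => // -[e].
  by rewrite -e beB0 in bB0.
have rel_a (i : 'I_(#|B| + m)) :
    eq_rel w (@asg_cat _ N _ _ (ctx_const _ _) (ctx_const _ _)
                (fun i : 'I_#|B| => fresh_tuple (enum_val i)) p i)
             (@asg_cat _ N _ _ (ctx_const _ _) (ctx_const _ _) x' p i).
  by rewrite /asg_cat /ctx_cat; case: (fintype.split i) => j.
exact/(eq_sat phi tN tN rel_a).
Qed.

End Fresh.

(** * Coding a society by the edges of one relation symbol *)

Section Code.
Variables (L L' : rel_language) (R0 : L').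
Hypothesis ar_gt0 : forall R : L, (0 < ar R)%N.
Hypothesis ar_le : forall R : L, (ar R <= ar R0)%N.

Definition slot : finType := (L * option 'I_(ar R0))%type.

Definition clip (R : L) (i : 'I_(ar R0)) : 'I_(ar R) :=
  insubd (Ordinal (ar_gt0 R)) (i : nat).

(** The edge coding the relation [R] at the tuple [t] consists of the vertices
    [(t j, (R, None))] and is filled up to the arity of [R0] by the padding
    vertices [(t 0, (R, Some i))] with [i >= ar R].  The tag [R] separates the
    symbols, and the tags [None] and [Some i] separate the entries of [t] from
    the padding, so that the edge determines [R] and the set of entries. *)
Definition code A (R : L) (t : 'I_(ar R) -> A) (i : 'I_(ar R0)) : A * slot :=
  (t (clip R i), (R, if (i < ar R)%N then None else Some i)).

Lemma val_clip R (i : 'I_(ar R0)) : (i < ar R)%N -> clip R i = i :> nat.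
Proof. by move=> iR; rewrite /clip val_insubd iR. Qed.

Lemma code_inj A (R : L) (t : 'I_(ar R) -> A) :
  injective t -> injective (code t).
Proof.
move=> injt i j [/injt e].
case: ifP => iR; case: ifP => jR //; last by case.
by move=> _; apply: val_inj; rewrite /= -(val_clip iR) -(val_clip jR) e.
Qed.

Lemma code_widen A (R : L) (t : 'I_(ar R) -> A) (i : 'I_(ar R)) :
  code t (widen_ord (ar_le R) i) = (t i, (R, None)).
Proof.
rewrite /code /= ltn_ord; congr (t _, _).
by apply: val_inj; rewrite /= val_clip /=.
Qed.

(** All symbols of [L'], not only [R0], receive the coding edges: comparing
    ranges avoids a case distinction on a dependent arity, and only [R0] is
    looked at when decoding.  The vertices in [B] lie on no edge. *)
Definition coded (A B : Type) (S : rel_structure L A) :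
    rel_structure L' ((A * slot) + B)%type :=
  fun R' x => injective x /\ exists (R : L) (t : 'I_(ar R) -> A), S R t /\
    forall u, (exists i, x i = u) <-> (exists i, inl (code t i) = u).

Lemma coded_society (A B : finType) (S : rel_structure L A) :
  S_ L' ((A * slot) + B)%type (@coded A B S).
Proof.
move=> R'; split=> [x []//|x p [injx [R [t [St xt]]]]]; split.
  by move=> i j /injx /perm_inj.
exists R, t; split=> // u; rewrite -xt; split=> -[i <-]; first by exists (p i).
by exists ((p^-1)%g i); rewrite permKV.
Qed.

(** The entries of [t] are recovered from the edge as the first components of
    its vertices tagged [(R, None)]. *)
Lemma coded_code (A : finType) B (S : rel_structure L A) (R : L)
    (t : 'I_(ar R) -> A) :
  S_ L A S ->
  S R t <-> coded S (R:=R0) (fun i => inl (code t i) : (A * slot) + B).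
Proof.
move=> socS; have [irrS symS] := socS R; split=> [St|].
  split; last by exists R, t.
  have inl_inj : injective (fun v : A * slot => inl v : A * slot + B).
    by move=> v v' [].
  exact: (inj_comp inl_inj (code_inj (irrS _ St))).
move=> [injx [R2 [t2 [St2 tt2]]]].
have RE : R2 = R.
  (* Any vertex of the edge carries its symbol as a tag. *)
  pose i0 := widen_ord (ar_le R) (Ordinal (ar_gt0 R)).
  have [/(_ (ex_intro _ i0 erefl)) [j] []] := tt2 (inl (code t i0)).
  by [].
subst R2; apply: (sym_range symS St2) => [i j e|i].
  have cE : code t (widen_ord (ar_le R) i) =
      code t (widen_ord (ar_le R) j) by rewrite !code_widen e.
  by apply: ord_inj; have /(congr1 val) := injx _ _ (congr1 inl cE).
have [/(_ (ex_intro _ (widen_ord (ar_le R) i) erefl)) [j]] :=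
  tt2 (inl (code t (widen_ord (ar_le R) i))).
by rewrite code_widen => -[e _ _]; exists (clip R j).
Qed.

Lemma coded_isolated (A B : Type) (S : rel_structure L A) (R' : L') x (b : B) :
  (exists i, x i = inr b) -> ~ coded S (R:=R') x.
Proof.
by move=> xb [_ [R [t [_ /(_ (inr b)) [/(_ xb) []]]]]].
Qed.

End Code.

(** * Comparing theories of societies *)

Section Interpretation.
Variables (L L' : rel_language) (R0 : L') (R1 : L).
Hypothesis ar_gt0 : forall R : L, (0 < ar R)%N.
Hypothesis ar_gt0' : forall R : L', (0 < ar R)%N.
Hypothesis ar_le : forall R : L, (ar R <= ar R0)%N.

Local Notation TL := (eq_theory (T_ (S_ L))).
Local Notation slot := (slot L R0).
Local Notation code := (code ar_gt0).

Section Decode.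
Variables (s : lsort (eq_language (T_ (S_ L)))) (l : nat).
Local Notation k := (rep_arity s).
Local Notation I := ('I_l * option ('I_k * slot))%type.

Definition position (p : ('I_l * 'I_k) * slot) : I :=
  (p.1.1, Some (p.1.2, p.2)).

(** The tuple [x] of society elements is the one coded by a family of vertices
    with equality pattern [e] and edges [S].  Two entries of [x] are equal when
    their codes agree at one slot; the slot [(R1, None)] serves as witness. *)
Definition decodes (N : structure (eq_language (T_ (S_ L))))
    (x : 'I_l * 'I_k -> N (inl tt)) (e : I -> I -> Prop)
    (S : rel_structure L' I) : Prop :=
  (forall p q, x p = x q <->
     e (position (p, (R1, None))) (position (q, (R1, None)))) /\
  (forall R t, pull (@eq_home L (S_ L) N) x (R:=R) t <->
     S R0 (fun i => position (code t i))).

Definition decoded_sat (psi : formula (ctx_const l s)) (e : I -> I -> Prop)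
    (S : rel_structure L' I) : Prop :=
  exists N, models TL N /\ exists x : 'I_l * 'I_k -> N (inl tt),
    decodes x e S /\ sat psi (fun j => rep (fun c => x (j, c))).

(** Different decodings of the same pattern carry isomorphic finite structures,
    so by [eq_sat] they agree on [psi]. *)
Lemma decoded_satP psi e S (N : structure (eq_language (T_ (S_ L))))
    (x : 'I_l * 'I_k -> N (inl tt)) :
  models TL N -> decodes x e S ->
  decoded_sat psi e S <-> sat psi (fun j => rep (fun c => x (j, c))).
Proof.
move=> tN [xe xS]; split=> [[N' [tN' [x' [[xe' xS'] sat']]]]|sat_x]; last first.
  by exists N; split=> //; exists x.
have [p q|R t|w [t [tx tx']]] := @pattern_world _ _ _
    (@eq_home L (S_ L) N) (@eq_home L (S_ L) N') _ x x'.
- by rewrite xe xe'.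
- by rewrite xS xS'.
apply: (proj2 (@eq_sat _ _ _ _ w _ _ psi _ _ tN tN' _) sat') => j.
exists (fun c => t (j, c)).
by split; congr rep; apply: funext => c; rewrite ?tx ?tx'.
Qed.

End Decode.

(** For a member of the age given by [f : B -> N s], the representatives of the
    values of [f] span a finite society.  Its code embeds in the generic
    [L']-society, and [b] is sent to the tuple of the vertices that code the
    representative of [f b], together with a private vertex.  The formulas
    [decoded_sat (psi i)] read the coordinates of these tuples, decode them and
    evaluate [psi i]. *)
Theorem eq_society_le : trianglelefteq TL (eq_theory (T_ (S_ L'))).
Proof.
move=> n m s psi.
pose V : finType := ('I_(rep_arity s) * slot)%type.
pose s2 := tuple_sort (S_ L') (option V).
pose phi (i : 'I_n) : formula (ctx_const (m i) s2) :=
  sval (cid (coordinate_formula (S_ L') (decoded_sat (psi i)))).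
exists s2, phi => C S [N [B [f [[tN _ _] isoS]]]].
have /choice [y yE] : forall b : B, exists y, f b = rep y.
  by move=> b; apply: rep_surj.
have [//|//|w [t [tl _]]] := @pattern_world _ _ _
    (@eq_home L (S_ L) N) (@eq_home L (S_ L) N)
    (B * 'I_(rep_arity s))%type (fun p => y p.1 p.2) (fun p => y p.1 p.2).
have socQ : S_ L (idx w) (dia w) := eq_age tN (lmap_emb w).
have /(random_age ar_gt0') [g g_emb] :=
  @coded_society L L' R0 ar_gt0 (idx w) B (dia w).
pose q (b : B) (v : V) : idx w * slot := (t (b, v.1), v.2).
pose f' := fresh_tuple L' g q.
exists _, B, f'; split.
  exact: (fresh_in_F ar_gt0' q g_emb (@coded_isolated _ _ _ _ _ _ _)).
have -> : B_ phi f' = B_ psi f; last exact: isoS.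
apply: functional_extensionality_dep => i; apply: funext => a.
apply: propext; rewrite /B_ /phi /f' /fresh_tuple; case: cid => /= ph phE.
pose Y (p : 'I_(m i) * option V) : nat :=
  if p.2 is Some v then g (inl (q (a p.1) v)) else g (inr (a p.1)).
apply: (iff_trans (phE _ (random_models ar_gt0') Y)).
pose x (p : 'I_(m i) * 'I_(rep_arity s)) := lmap (t (a p.1, p.2)).
have dx : decodes x (fun p q => Y p = Y q) (pull (@random L') Y).
  split=> [p p'|R u].
    rewrite /x /Y /q /=; split=> [/(proj1 (lmap_emb w)) ->//|].
    by move=> /(proj1 g_emb) [->].
  apply: (iff_trans (iff_sym
    (proj2 (lmap_emb w) R (fun j => t (a (u j).1, (u j).2))))).
  apply: (iff_trans (coded_code ar_gt0 ar_le B _ socQ)).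
  exact: (iff_trans (proj2 g_emb R0 _)).
apply: (iff_trans (decoded_satP (psi i) tN dx)).
have -> // : (fun j => rep (fun c => x (j, c))) = (fun j => f (a j)).
by apply: funext => j; rewrite yE; congr rep; apply: funext => c; rewrite /x tl.
Qed.

End Interpretation.

Lemma trianglelefteq_trans (L1 L2 L3 : language) (T1 : theory L1)
    (T2 : theory L2) (T3 : theory L3) :
  trianglelefteq T1 T2 -> trianglelefteq T2 T3 -> trianglelefteq T1 T3.
Proof.
move=> le12 le23 N n s1 phi1.
have [s2 [phi2 sub12]] := le12 N n s1 phi1.
have [s3 [phi3 sub23]] := le23 N n s2 phi2.
by exists s3, phi3 => C S /sub12/sub23.
Qed.

Lemma H_S_ r : H_ r = S_ (hypergraph_language r).
Proof.
apply: functional_extensionality_dep => A; apply/predeqP => S.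
by split=> [h []|h]; [exact: h | exact: h tt].
Qed.

Theorem corollary4p25 (L : rel_language) (L_nonempty : (0 < #|L|)%N)
    (L_ar : forall R : L, (2 <= ar R)%N) :
  forall T : TT, C_ (S_ L) T <-> C_ (H_ (ari L)) T.
Proof.
move=> T.
have [R1 ariE] : {R1 : L | ari L = ar R1} by apply: eq_bigmax.
have ar_gt0 (R : L) : (0 < ar R)%N by apply: ltnW.
have ari_gt0 (R : hypergraph_language (ari L)) : (0 < ar R)%N.
  by rewrite /= ariE.
rewrite H_S_; split; apply: trianglelefteq_trans.
  apply: (eq_society_le (L:=hypergraph_language (ari L)) (R0:=R1) tt) => // R.
  by rewrite /= ariE.
apply: (eq_society_le (L':=hypergraph_language (ari L)) (R0:=tt) R1) => // R.
exact: leq_bigmax.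
Qed.
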